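(* Let $X$ be a Hilbert space, $\mathcal J$ a Euclidean Jordan algebra with cone of squares $\mathcal K$ (an arbitrary symmetric cone), $K : X \to \mathcal J$ a bounded linear operator, $A : \mathcal J \to \mathbb R^k$ linear, $b \in \mathbb R^k$, and suppose there exists some $y \in \operatorname{int}\mathcal K$ with $Ay=b$. Let $G : X \to (-\infty,\infty]$ be proper, lower semicontinuous, and strongly convex with factor $\gamma>0$. Assume that $Ay=b$ implies $\langle a, y\rangle = b_0$ for some $a \in \operatorname{int}\mathcal K$ and $b_0>0$. Suppose there exists a solution $(\hat x,\hat y,\hat d,\hat z) \in X\times\mathcal K\times\mathcal K\times\mathbb R^k$ to $$-K^*\hat y \in \partial G(\hat x),\qquad A\hat y=b,\qquad A^*\hat z-K\hat x=\hat d,\qquad \hat y\circ\hat d=0,$$ with $\hat y$ and $\hat d$ strictly complementary, $\hat d$ dual non-degenerate, and $\hat y$ primal non-degenerate. For some constants $\theta>0$ and $\zeta\in(0,b_0^{-2})$, let the sequence $\{x^i\}_{i\in\mathbb N}$ be generated by the barrier-preconditioned primal--dual method (described in the context) with $$\mu_{i+1} := \theta\,\phi_i^{-1/2},\qquad \omega_{*,i+1} := \zeta\,\lambda_{\min}(a)\,\mu_{i+1}.$$ Suppose further that $\operatorname{dom} G$ is bounded, or that the primal iterates $\{x^i\}_{i\in\mathbb N}$ stay bounded through other means. Then $\|x^N-\hat x\|^2 = O(1/N)$.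
   Context: **Jordan algebras.** A Euclidean Jordan algebra $\mathcal J$ is a (finite-dimensional) real vector space with a bilinear commutative product $\circ$ satisfying $x\circ(x^2\circ y)=x^2\circ(x\circ y)$, where $x^2=x\circ x$, and such that $x^2+y^2=0$ implies $x=y=0$. It has a unit $e$. Each $x\in\mathcal J$ has a spectral decomposition $x=\sum_{i=1}^r\lambda_i(x)e_i$, where $r$ is the rank of $\mathcal J$ and $\{e_i\}$ is a Jordan frame (primitive idempotents with $e_i\circ e_j=0$ for $i\neq j$ and $\sum_i e_i=e$); $\lambda_{\min}(x)$, $\lambda_{\max}(x)$ are the smallest and largest eigenvalues $\lambda_i(x)$. The inner product is $\langle x,y\rangle=\operatorname{tr}(x\circ y)$ with $\operatorname{tr}x=\sum_i\lambda_i(x)$, and $\|x\|=\sqrt{\langle x,x\rangle}$. The cone of squares is $\mathcal K=\{x^2: x\in\mathcal J\}$ (elements with non-negative eigenvalues); $\operatorname{int}\mathcal K$ consists of elements with all eigenvalues positive. Adjoints are with respect to the given inner products. **Complementarity and non-degeneracy.** $\hat y,\hat d\in\mathcal K$ with $\hat y\circ\hat d=0$ are strictly complementary if $\hat y+\hat d\in\operatorname{int}\mathcal K$. $\hat y$ is primal non-degenerate if [$v=A^*z$ for some $z$ and $\hat y\circ v=0$] implies $v=0$. $\hat d$ is dual non-degenerate if [$Av=0$ and $\hat d\circ v=0$] implies $v=0$. **Strong convexity.** $G$ is strongly convex with factor $\gamma$ if $G-\frac{\gamma}{2}\|\cdot\|^2$ is convex; $\partial G$ is the convex subdifferential. **Barrier-preconditioned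 primal--dual method.** It is applied to $\min_x\max_y G(x)+\langle Kx,y\rangle-F^*(y)$ with $F^*=\delta_{\{y: Ay=b\}}+\delta_{\mathcal K}$ (indicator functions). Choose an initial iterate $x^0\in X$ and set $\phi_0:=1$. For $i=0,1,2,\dots$, given rules for $\mu_{i+1}>0$ and $\omega_{*,i+1}>0$: 1. $\tau_i:=2\omega_{*,i+1}/\|K\|^2$; 2. $\phi_{i+1}:=\phi_i(1+2\gamma\tau_i)$; 3. solve for $(y^{i+1},d^{i+1},z^{i+1})\in\operatorname{int}\mathcal K\times\operatorname{int}\mathcal K\times\mathbb R^k$ the system $Ay^{i+1}=b$, $A^*z^{i+1}-Kx^i=d^{i+1}$, $y^{i+1}\circ d^{i+1}=\mu_{i+1}e$; 4. $x^{i+1}:=(I+\tau_i\partial G)^{-1}(x^i-\tau_iK^*y^{i+1})$. *)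

(* Defs.v *)
From HB Require Import structures.
From mathcomp Require Import all_boot all_order all_algebra.
From mathcomp Require Import all_classical all_reals all_analysis.

Set Implicit Arguments.
Unset Strict Implicit.
Unset Printing Implicit Defensive.

Import Order.TTheory GRing.Theory Num.Theory.
Import numFieldNormedType.Exports.

Local Open Scope classical_set_scope.
Local Open Scope ring_scope.

HB.mixin Record CompleteNormedModule_isHilbert (R : realType) X
    & CompleteNormedModule R X := {
  hdot : {dot X for (@idfun R)} ;
  hdot_norm : forall x : X, hdot x x = `|x| ^+ 2
}.

#[short(type="hilbertType")]
HB.structure Definition Hilbert (R : realType) :=
  {X of CompleteNormedModule_isHilbert R X & CompleteNormedModule R X}.

(* [Vector] makes the space finite-dimensional. *)
HB.mixin Record Vector_isEuclideanJordan (R : realType) J & Vector R J := {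
  jmul : {bilinear J -> J -> J} ;
  junit : J ;
  jmulC : forall x y : J, jmul x y = jmul y x ;
  jmul1 : forall x : J, jmul junit x = x ;
  jmul_jordan : forall x y : J,
    jmul x (jmul (jmul x x) y) = jmul (jmul x x) (jmul x y) ;
  jmul_real : forall x y : J, jmul x x + jmul y y = 0 -> x = 0 /\ y = 0
}.

#[short(type="euclideanJordanType")]
HB.structure Definition EuclideanJordan (R : realType) :=
  {J of Vector_isEuclideanJordan R J & Vector R J}.

Section Jordan.
Context {R : realType} {J : euclideanJordanType R}.
Implicit Types (x y c u v : J) (s : seq R).

Definition jidempotent c := jmul c c = c.

(* The two summands are automatically orthogonal. *)
Definition jprimitive c := [/\ c != 0, jidempotent c &
  forall u v, jidempotent u -> jidempotent v -> u + v = c -> u = 0 \/ v = 0].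

Definition jordan_frame (r : nat) (c : 'I_r -> J) := [/\
  forall i, jprimitive (c i),
  forall i j, i != j -> jmul (c i) (c j) = 0 &
  \sum_(i < r) c i = junit].

(* [s] lists the eigenvalues of [x], with multiplicity, in decreasing order. *)
Definition is_spectrum x s := sorted >=%R s /\
  exists2 c : 'I_(size s) -> J, jordan_frame c &
    x = \sum_(i < size s) s`_i *: c i.

(* By the spectral theorem exactly one [s] satisfies [is_spectrum x s], and its
   size is the rank of [J]: the choice made by [xget] is immaterial. *)
Definition eigenvalues x : seq R := xget [::] (is_spectrum x).

Definition lambda_min x : R := last 0 (eigenvalues x).

Definition jtr x : R := \sum_(l <- eigenvalues x) l.
Definition jdot x y : R := jtr (jmul x y).
Definition jnorm x : R := Num.sqrt (jdot x x).

Definition jcone : set J := [set x | exists y, x = jmul y y].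

(* [J] carries no library topology: interior for the topology of [jnorm]. *)
Definition jinterior (C : set J) : set J :=
  [set x | exists2 eps : R, 0 < eps & forall y, jnorm (y - x) < eps -> C y].

Definition strictly_complementary y d := jinterior jcone (y + d).

End Jordan.

(* The adjoint of [f : U -> V]; the vector is unique when it exists ([dotU] is definite), and it
   exists (Riesz) for bounded [f] on a complete space. *)
Definition adjoint {R : realType} {U V : lmodType R}
    (dotU : U -> U -> R) (dotV : V -> V -> R) (f : U -> V) (v : V) : U :=
  xget 0 [set u | forall w, dotV (f w) v = dotU w u].

Definition cdot {R : realType} {k : nat} (z w : 'cV[R]_k) : R :=
  \sum_(i < k) z i 0 * w i 0.

Section Operators.
Context {R : realType} {X : hilbertType R} {J : euclideanJordanType R}.

Definition bounded_operator (K : X -> J) :=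
  exists M : R, forall x, jnorm (K x) <= M * `|x|.

Definition opnorm (K : X -> J) : R :=
  sup [set jnorm (K x) | x in [set x : X | `|x| <= 1]].

Definition adjK (K : X -> J) : J -> X := adjoint (@hdot R X) jdot K.

Definition adjA {k : nat} (A : J -> 'cV[R]_k) : 'cV[R]_k -> J :=
  adjoint jdot cdot A.

Definition primal_nondegenerate {k : nat} (A : J -> 'cV[R]_k) (y : J) :=
  forall v : J, (exists z, v = adjA A z) -> jmul y v = 0 -> v = 0.

Definition dual_nondegenerate {k : nat} (A : J -> 'cV[R]_k) (d : J) :=
  forall v : J, A v = 0 -> jmul d v = 0 -> v = 0.

End Operators.

Section Convex.
Context {R : realType} {X : hilbertType R}.
Implicit Types (G : X -> \bar R) (x v : X).
Local Open Scope ereal_scope.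

Definition edom G : set X := [set x | G x < +oo].

Definition eproper G := (forall x, G x != -oo) /\ edom G !=set0.

Definition econvex G := forall x v (t : R), (0 < t < 1)%R ->
  G (t *: x + (1 - t) *: v)%R <= t%:E * G x + (1 - t)%:E * G v.

Definition strongly_convex G (gamma : R) :=
  econvex (fun x => G x - (gamma / 2 * `|x| ^+ 2)%:E).

Definition subdifferential G x : set X :=
  [set g | forall v, G x + (hdot g (v - x)%R)%:E <= G v].

(* The value set at [v] of the inverse of the set-valued map [I + tau T]. *)
Definition resolvent (tau : R) (T : X -> set X) v : set X :=
  [set x | exists2 g, T x g & v = (x + tau *: g)%R].

End Convex.

(* Entries [mu 0], [omega 0], [y 0], [d 0], [z 0] are never used. *)
Record barrier_primal_dual {R : realType} {X : hilbertType R}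
    {J : euclideanJordanType R} {k : nat}
    (G : X -> \bar R) (gamma : R) (K : X -> J) (A : J -> 'cV[R]_k)
    (b : 'cV[R]_k) (mu omega phi tau : nat -> R)
    (x : nat -> X) (y d : nat -> J) (z : nat -> 'cV[R]_k) : Prop := {
  bpd_mu_gt0 : forall i, 0 < mu i.+1 ;
  bpd_omega_gt0 : forall i, 0 < omega i.+1 ;
  bpd_phi0 : phi 0%N = 1 ;
  bpd_tau : forall i, tau i = 2 * omega i.+1 / opnorm K ^+ 2 ;
  bpd_phiS : forall i, phi i.+1 = phi i * (1 + 2 * gamma * tau i) ;
  bpd_y_int : forall i, jinterior jcone (y i.+1) ;
  bpd_d_int : forall i, jinterior jcone (d i.+1) ;
  bpd_primal : forall i, A (y i.+1) = b ;
  bpd_dual : forall i, adjA A (z i.+1) - K (x i) = d i.+1 ;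
  bpd_compl : forall i, jmul (y i.+1) (d i.+1) = mu i.+1 *: junit ;
  bpd_step : forall i,
    resolvent (tau i) (subdifferential G) (x i - tau i *: adjK K (y i.+1))
      (x i.+1)
}.

(* Main.v *)
Require Import Defs.
From mathcomp Require Import all_boot all_order all_algebra.
From mathcomp Require Import all_classical all_reals all_analysis.
From mathcomp Require Import ring lra.
From mathcomp.real_closed Require Import complex.

Set Implicit Arguments.
Unset Strict Implicit.
Unset Printing Implicit Defensive.

Import Order.TTheory GRing.Theory Num.Theory.
Import numFieldNormedType.Exports.

Local Open Scope classical_set_scope.
Local Open Scope ring_scope.

(** The convergence estimate is short once the inner product of J is known to
    be one. Compare an iterate with the solution in the strong monotonicity
    inequality of the subdifferential. The coupling term splits into the
    complementarity gap of (y, d) against (yhat, dhat), which is at least minus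
    mu times the rank of J by self-duality of the cone, and a term that the
    squared length of the primal step absorbs up to O(tau^2); the dual iterates
    are bounded because a is interior to the cone and <a, y> = b0. Hence
    (lemma [primal_dual_descent])

      phi_(i+1) |x^(i+1) - xhat|^2 <= phi_i |x^i - xhat|^2 + phi_i O(mu^2),

    as tau is proportional to mu. Since mu = theta phi_i^(-1/2), the error is a
    constant, and phi_N |x^N - xhat|^2 grows at most linearly, while
    phi_(i+1) = phi_i + s phi_i^(1/2) forces phi_N to grow quadratically
    ([sqrt_growth]). The quotient is O(1/N).

    The adjoint of K exists by the Riesz theorem, proved by minimizing a
    quadratic functional ([riesz_representation]).

    The main work is algebraic. The trace is defined by eigenvalues, so even its
    additivity needs an argument. The spectral theorem ([eigenvaluesP]) comes
    from polynomials in one element: formal reality reduces an annihilating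
    polynomial to one with simple real roots, and interpolation yields
    idempotents, which split into primitive ones. The form that sends x, y to
    the trace of the multiplication operator of x y is associative because
    operator traces are cyclic ([trformA]) and positive definite by the spectral
    theorem. For primitive idempotents c and u that are not orthogonal for this
    form, computing the compression of u by c in two ways shows that c and u
    have the same square norm ([primitive_aip_eq]); dividing by these weights
    yields an associative linear functional equal to 1 on every primitive
    idempotent ([trace_density]), and this functional must be the sum of the
    eigenvalues. So the inner product is bilinear, associative and positive
    definite ([jdot_aip]). *)

(** * Linearization of the Jordan identity *)

Section JordanIdentities.
Context {R : realType} {J : euclideanJordanType R}.
Implicit Types x y z w c u v : J.

(** Linear forms separate points: linear identities in J become linear
    identities between reals. *)
Lemma jext x y : (forall f : {scalar J}, f x = f y) -> x = y.
Proof.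
move=> h; rewrite (coord_vbasis (memvf x)) (coord_vbasis (memvf y)).
by apply: eq_bigr => i _; rewrite h.
Qed.

Lemma scalD (f : {scalar J}) x y : f (x + y) = f x + f y.
Proof. exact: raddfD. Qed.
Lemma scalN (f : {scalar J}) x : f (- x) = - f x.
Proof. exact: raddfN. Qed.
Lemma scal0 (f : {scalar J}) : f 0 = 0.
Proof. exact: raddf0. Qed.
Lemma scalZ (f : {scalar J}) t x : f (t *: x) = t * f x.
Proof. exact: linearZ. Qed.
Definition scalE := (scalD, scalN, scalZ, scal0).

Lemma jmulDl x y z : jmul (x + y) z = jmul x z + jmul y z.
Proof. exact: linearDl. Qed.
Lemma jmulDr x y z : jmul z (x + y) = jmul z x + jmul z y.
Proof. exact: linearDr. Qed.
Lemma jmulBl x y z : jmul (x - y) z = jmul x z - jmul y z.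
Proof. exact: linearBl. Qed.
Lemma jmulBr x y z : jmul z (x - y) = jmul z x - jmul z y.
Proof. exact: linearBr. Qed.
Lemma jmulZl t x z : jmul (t *: x) z = t *: jmul x z.
Proof. exact: linearZl_LR. Qed.
Lemma jmulZr t x z : jmul z (t *: x) = t *: jmul z x.
Proof. exact: linearZr. Qed.
Lemma jmul0l z : jmul 0 z = 0.
Proof. exact: linear0l. Qed.
Lemma jmul0r z : jmul z 0 = 0.
Proof. exact: linear0r. Qed.
Lemma jmulr1 x : jmul x junit = x.
Proof. by rewrite jmulC jmul1. Qed.

Lemma jmul_suml (I : Type) (r : seq I) (P : pred I) (F : I -> J) z :
  jmul (\sum_(i <- r | P i) F i) z = \sum_(i <- r | P i) jmul (F i) z.
Proof. exact: (big_morph (jmul^~ z) (fun x y => jmulDl x y z) (jmul0l z)). Qed.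
Lemma jmul_sumr (I : Type) (r : seq I) (P : pred I) (F : I -> J) z :
  jmul z (\sum_(i <- r | P i) F i) = \sum_(i <- r | P i) jmul z (F i).
Proof. exact: (big_morph (jmul z) (fun x y => jmulDr x y z) (jmul0r z)). Qed.

(** Evaluation at x + y and at x + 2 y separates the terms of the two mixed
    degrees in x and y. *)
Lemma cubic_polarization (F : J -> J -> J -> J) :
  (forall x y u v, F (x + y) u v = F x u v + F y u v) ->
  (forall x y u v, F u (x + y) v = F u x v + F u y v) ->
  (forall x y z, F x y z = F x z y) ->
  (forall x, F x x x = 0) ->
  forall x y z, F x y z + F y z x + F z x y = 0.
Proof.
move=> D1 D2 S0 F0.
have D3 x y u v : F u v (x + y) = F u v x + F u v y.
  by rewrite S0 D2 !(S0 u v).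
have half x y : F y x x + (F x y x + F x y x) = 0.
  have h1 := F0 (x + y); have h2 := F0 (x + (y + y)).
  have h3 := F0 x; have h4 := F0 y.
  move: h1 h2; rewrite !D1 !D2 !D3 !h3 !h4 !(S0 x x y) !(S0 y x y) => h1 h2.
  apply: jext => f; have := congr1 f h1; have := congr1 f h2.
  by rewrite !scalE; lra.
move=> x y z; have := half (x + z) y; have := half x y; have := half z y.
rewrite !D1 !D2 !D3 (S0 y z x) (S0 x y z) (S0 z x y) => h1 h2 h3.
apply: jext => f; have := congr1 f h1; have := congr1 f h2.
by have := congr1 f h3; rewrite !scalE; lra.
Qed.

(** Polarization of the Jordan identity, which is cubic in its first argument;
    the identities below are specializations. *)
Lemma jordan_linearized x y z w :
  jmul x (jmul (jmul y z) w) + jmul y (jmul (jmul z x) w)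
    + jmul z (jmul (jmul x y) w)
  = jmul (jmul y z) (jmul x w) + jmul (jmul z x) (jmul y w)
    + jmul (jmul x y) (jmul z w).
Proof.
pose F u1 u2 u3 :=
  jmul u1 (jmul (jmul u2 u3) w) - jmul (jmul u2 u3) (jmul u1 w).
have h : F x y z + F y z x + F z x y = 0.
  apply: cubic_polarization => [x' y' u v|x' y' u v|x' y' z'|x']; rewrite /F.
  - by rewrite (jmulDl x' y') (jmulDl x' y' w) (jmulDr _ _ (jmul u v)) opprD addrACA.
  - by rewrite (jmulDl x' y' v) !jmulDl jmulDr opprD addrACA.
  - by rewrite (jmulC y').
  - by rewrite jmul_jordan subrr.
move: h; rewrite /F => h; apply/eqP; rewrite -subr_eq0 -h; apply/eqP.
by apply: jext => f; rewrite !scalE; ring.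
Qed.

End JordanIdentities.

(** * Peirce relations and power associativity *)

Section Peirce.
Context {R : realType} {J : euclideanJordanType R}.
Implicit Types x y z w c u v : J.

(** Multiplication by an idempotent has its eigenvalues among 0, 1/2 and 1. *)
Lemma jmul_peirce c y : jidempotent c ->
  2 *: jmul c (jmul c (jmul c y)) + jmul c y = 3 *: jmul c (jmul c y).
Proof.
rewrite /jidempotent => cc; have := jordan_linearized c y c c.
rewrite !cc (jmulC y c) !(jmulC _ c) => h; apply: jext => f.
have := congr1 f h; rewrite !scalE; lra.
Qed.

Lemma jmul_orth_comm u v y : jidempotent u -> jmul u v = 0 ->
  jmul u (jmul v y) = jmul v (jmul u y).
Proof.
rewrite /jidempotent => uu uv; have := jordan_linearized u u v y.
by rewrite (jmulC v u) uv uu !(jmul0l, jmul0r) !add0r => ->.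
Qed.

(** The linearized identity at u, x, v and u reads v x + v x = v x. *)
Lemma peirce1_orth u v x : jidempotent u -> jmul u v = 0 ->
  jmul u x = x -> jmul v x = 0.
Proof.
move=> uu uv ux; have := jordan_linearized u x v u.
rewrite (jmulC v u) uv !(jmulC _ u) uu !ux (jmulC x v).
rewrite !(jmul_orth_comm _ uu uv) !ux !(jmul0l, jmul0r) !addr0.
rewrite (jmulC _ u) (jmul_orth_comm _ uu uv) ux.
by move=> /eqP; rewrite -subr_eq0 addrK => /eqP.
Qed.

Lemma peirce1_closed c x y : jidempotent c -> jmul c x = x -> jmul c y = y ->
  jmul c (jmul x y) = jmul x y.
Proof.
move=> cc cx cy; have := jordan_linearized c c x y.
rewrite (jmulC x c) cc !cx !cy => h; apply: jext => f.
by have := congr1 f h; rewrite !scalE; lra.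
Qed.

Lemma jidempotentD_orth u v : jidempotent u -> jidempotent v ->
  jidempotent (u + v) -> jmul u v = 0.
Proof.
rewrite /jidempotent => uu vv; rewrite !jmulDl !jmulDr uu vv (jmulC v u) => h.
by apply: jext => f; have := congr1 f h; rewrite !scalE; lra.
Qed.

Lemma jsqr_eq0 x : jmul x x = 0 -> x = 0.
Proof.
move=> xx; have := @jmul_real R J x 0; rewrite xx jmul0l addr0.
by case=> //.
Qed.

End Peirce.

Section PowerAssociativity.
Context {R : realType} {J : euclideanJordanType R}.
Implicit Types (x y z w c u v : J) (p q : {poly R}).

Definition jpow x n := iter n (jmul x) junit.

Let com x (f : J -> J) := (forall y, f (jmul x y) = jmul x (f y)) /\
  (forall y, f (jmul (jmul x x) y) = jmul (jmul x x) (f y)).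

Let comD x (f g : J -> J) : com x f -> com x g -> com x (fun y => f y + g y).
Proof. by move=> [f1 f2] [g1 g2]; split=> y; rewrite jmulDr ?f1 ?g1 ?f2 ?g2. Qed.

Let comB x (f g : J -> J) : com x f -> com x g -> com x (fun y => f y - g y).
Proof. by move=> [f1 f2] [g1 g2]; split=> y; rewrite jmulBr ?f1 ?g1 ?f2 ?g2. Qed.

Let com_comp x (f g : J -> J) : com x f -> com x g -> com x (fun y => f (g y)).
Proof. by move=> [f1 f2] [g1 g2]; split=> y; rewrite ?g1 ?f1 ?g2 ?f2. Qed.

Let com_self x : com x (jmul x).
Proof. by split=> // y; rewrite jmul_jordan. Qed.

Let com_sqr x : com x (jmul (jmul x x)).
Proof. by split=> // y; rewrite jmul_jordan. Qed.

(** The linearized identity writes multiplication by a power of x as a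
    polynomial in the multiplications by lower powers, so all of them commute
    with those by x and by its square. *)
Let jpow_commutes x n : com x (jmul (jpow x n)).
Proof.
suff: com x (jmul (jpow x n)) /\ com x (jmul (jpow x n.+1)) by case.
elim: n => [|n [hn hSn]].
  split; last by rewrite /= jmulr1; apply: com_self.
  by split=> y; rewrite !jmul1.
split=> //; set u := jpow x n in hn; set v := jpow x n.+1 in hSn.
have vE : v = jmul u x by rewrite /v /= jmulC.
have -> : jmul (jpow x n.+2) = fun y => jmul (jmul x x) (jmul u y)
    + jmul v (jmul x y) + jmul v (jmul x y) - jmul x (jmul x (jmul u y))
    - jmul u (jmul x (jmul x y)).
  apply: funext => y; have := jordan_linearized x y u x.
  rewrite -vE (jmulC y u) (jmulC y x) !(jmulC _ x) (jmulC _ (jmul x x)) /=.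
  rewrite -/(jpow x n.+1) -/v (jmulC y) (jmulC _ v) (jmulC (jmul x y) v) => h.
  by apply: jext => f; have := congr1 f h; rewrite !scalE; lra.
have cx := com_self x; have cvx := com_comp hSn cx.
have cxu := com_comp cx (com_comp cx hn); have cux := com_comp hn (com_comp cx cx).
exact: comB (comB (comD (comD (com_comp (com_sqr x) hn) cvx) cvx) cxu) cux.
Qed.

Definition jhorner x p := \sum_(i < size p) p`_i *: jpow x i.

Lemma jhorner_widen x p n : (size p <= n)%N ->
  jhorner x p = \sum_(i < n) p`_i *: jpow x i.
Proof.
move=> hn; rewrite /jhorner (big_ord_widen n (fun i => p`_i *: jpow x i) hn).
rewrite big_mkcond /=; apply: eq_bigr => i _; case: ltnP => // h.
by rewrite nth_default // scale0r.
Qed.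

Lemma jhornerD x p q : jhorner x (p + q) = jhorner x p + jhorner x q.
Proof.
rewrite (jhorner_widen x (size_polyD p q)).
rewrite (jhorner_widen x (leq_maxl (size p) (size q))).
rewrite (jhorner_widen x (leq_maxr (size p) (size q))) -big_split /=.
by apply: eq_bigr => i _; rewrite coefD scalerDl.
Qed.

Lemma jhornerZ x t p : jhorner x (t *: p) = t *: jhorner x p.
Proof.
rewrite (jhorner_widen x (size_scale_leq t p)) /jhorner scaler_sumr.
by apply: eq_bigr => i _; rewrite coefZ scalerA.
Qed.

Lemma jhornerC x t : jhorner x t%:P = t *: junit.
Proof.
by rewrite (jhorner_widen x (size_polyC_leq1 t)) big_ord1 coefC.
Qed.

(** Multiplication by q(x) is a combination of multiplications by powers of x,
    hence commutes with multiplication by x. *)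
Lemma jhornerMX x p : jhorner x (p * 'X) = jmul x (jhorner x p).
Proof.
rewrite (jhorner_widen x (size_polyMleq p 'X)) size_polyX addn2 /=.
rewrite big_ord_recl coefMX /= scale0r add0r /jhorner jmul_sumr.
by apply: eq_bigr => i _; rewrite coefMX /= jmulZr.
Qed.

Lemma jhornerX x : jhorner x 'X = x.
Proof. by rewrite -['X]mul1r jhornerMX jhornerC scale1r jmulr1. Qed.

Lemma jhornerM x p q : jhorner x (p * q) = jmul (jhorner x p) (jhorner x q).
Proof.
elim/poly_ind: p => [|p c IH].
  by rewrite mul0r jhornerC scale0r jmul0l.
rewrite mulrDl mul_polyC !jhornerD jhornerZ jhornerC jhornerMX.
rewrite -mulrA ['X * q]mulrC mulrA jhornerMX IH jmulDl jmulZl jmul1.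
congr (_ + _); rewrite [RHS]jmulC (jmulC (jhorner x p)).
rewrite /(jhorner x q) !jmul_suml jmul_sumr; apply: eq_bigr => i _.
by rewrite !jmulZl jmulZr (proj1 (jpow_commutes x i)).
Qed.

Lemma jhornerN x p : jhorner x (- p) = - jhorner x p.
Proof. by rewrite -(scaleN1r p) jhornerZ scaleN1r. Qed.

(** The algebra generated by x has no nilpotent element. *)
Lemma jhorner_eq0_pow x p : jhorner x (p ^+ 2) = 0 -> jhorner x p = 0.
Proof. by rewrite expr2 jhornerM => /jsqr_eq0. Qed.

(** There are more powers of x than the dimension allows to be independent. *)
Lemma jhorner_annihilator x : exists2 p, p != 0 & jhorner x p = 0.
Proof.
apply: contrapT => h.
pose n := \dim (fullv : {vspace J}).
pose X := [tuple jpow x i | i < n.+1].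
have : free X.
  apply/freeP => k hk i; apply: contrapT => ki; apply: h.
  exists (\poly_(i < n.+1) k (inord i)); last first.
    rewrite (jhorner_widen x (size_poly _ _)) -[RHS]hk.
    apply: eq_bigr => j _; rewrite coef_poly ltn_ord inord_val.
    by rewrite -tnth_nth tnth_mktuple.
  apply/eqP => /(congr1 (fun q : {poly R} => q`_i)).
  by rewrite coef_poly ltn_ord inord_val coef0 => /ki.
rewrite /free size_tuple => /eqP hd.
by have := dimvS (subvf <<X>>); rewrite hd ltnn.
Qed.

End PowerAssociativity.

(** * Spectral decomposition *)

Section Spectral.
Context {R : realType} {J : euclideanJordanType R}.
Implicit Types (x y z w c u v : J) (p q g : {poly R}).

(** The remainder has degree at most one and real coefficients, and vanishes at
    a point that is not real. *)
Lemma complex_root_dvd p (a b : R) : b != 0 ->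
  root (map_poly (real_complex R) p) (Complex a b) ->
  ('X - a%:P) ^+ 2 + (b ^+ 2)%:P %| p.
Proof.
move=> b0; set d := _ + _ => pz.
have sd : size d = 3%N.
  rewrite /d size_polyDl ?size_exp_XsubC //.
  by rewrite (leq_ltn_trans (size_polyC_leq1 _)).
have d0 : d != 0 by rewrite -size_poly_gt0 sd.
have : root (map_poly (real_complex R) (p %% d)) (Complex a b).
  move: pz; rewrite {1}(divp_eq p d) rmorphD rmorphM !rootE hornerD hornerM.
  suff -> : (map_poly (real_complex R) d).[Complex a b] = 0 by rewrite mulr0 add0r.
  rewrite /d rmorphD rmorphXn /= rmorphB /= map_polyX !map_polyC /=.
  rewrite !hornerE; apply/eqP; rewrite eq_complex; apply/andP; split; apply/eqP => /=; ring.
have : (size (p %% d)%R < 3)%N by rewrite -sd ltn_modp.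
rewrite /dvdp; set r := p %% d => sr.
have -> : r = r`_1 *: 'X + (r`_0)%:P.
  apply/polyP => i; rewrite coefD coefZ coefX coefC.
  case: i => [|[|i]] /=; rewrite ?mulr0 ?mulr1 ?addr0 ?add0r //.
  by rewrite nth_default // -ltnS (leq_trans sr).
rewrite rmorphD /= map_polyC map_polyZ map_polyX rootE !hornerE /=.
rewrite eq_complex /= !mul0r subr0 !addr0 mulf_eq0 (negPf b0) orbF.
by move=> /andP[h1 /eqP h2]; move: h1; rewrite h2 mul0r add0r => /eqP ->; rewrite scale0r add0r.
Qed.

(** Multiplied by p, the hypothesis says that two squares of the algebra
    generated by x add up to zero. *)
Lemma jhorner_quadratic_reduce x p (a b : R) : b != 0 ->
  jhorner x ((('X - a%:P) ^+ 2 + (b ^+ 2)%:P) * p) = 0 -> jhorner x p = 0.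
Proof.
move=> b0 h.
have : jhorner x ((('X - a%:P) * p) * (('X - a%:P) * p) + (b *: p) * (b *: p)) = 0.
  rewrite -(jmul0l (jhorner x p)) -h -jhornerM -mul_polyC; congr (jhorner x _).
  by rewrite rmorphXn /=; ring.
rewrite jhornerD !jhornerM => /jmul_real[_].
by rewrite jhornerZ => /eqP; rewrite scaler_eq0 (negPf b0) => /eqP.
Qed.

(** The factors of an annihilating polynomial are removed one root at a time:
    by formal reality a pair of conjugate roots can be dropped, and a repeated
    real root can be kept just once. The cofactor g stores the real factors
    already met. *)
Lemma jhorner_split_annihilator x p g : p != 0 -> jhorner x (p * g) = 0 ->
  exists2 s, uniq s & jhorner x ((\prod_(a <- s) ('X - a%:P)) * g) = 0.
Proof.
have [n] := ubnP (size p); elim: n p g => // n IH p g /ltnSE sp p0 pg.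
have [/eqP/size_poly1P[c c0 pc]|sp1] := eqVneq (size p) 1%N.
  exists [::] => //; rewrite big_nil mul1r.
  by move/eqP: pg; rewrite pc mul_polyC jhornerZ scaler_eq0 (negPf c0) => /eqP.
have /closed_rootP[[a b]] : size (map_poly (real_complex R) p) != 1%N.
  by rewrite size_map_poly.
have [-> | b0] := eqVneq b 0.
  rewrite -[Complex a 0]/(real_complex R a) fmorph_root => /factor_theorem[q pq].
  have q0 : q != 0 by apply: contraNneq p0 => q0; rewrite pq q0 mul0r.
  have [||s us hs] := IH q (('X - a%:P) * g) _ q0; last 1 first.
  - have [as_|as_] := boolP (a \in s); last first.
      exists (a :: s); first by rewrite /= as_.
      by rewrite big_cons -mulrA mulrCA.
    exists s => //; apply: jhorner_eq0_pow; move: hs.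
    rewrite (big_rem a as_) /=; set P := \prod_(_ <- _) _ => hs.
    rewrite -[LHS]/(jhorner x _).
    have -> : (('X - a%:P) * P * g) ^+ 2
       = (('X - a%:P) * P * (('X - a%:P) * g)) * (P * g) by ring.
    by rewrite jhornerM hs jmul0l.
  - apply: leq_trans sp; rewrite pq size_Mmonic ?monicXsubC // size_XsubC addn2.
    by [].
  - by rewrite mulrA -pq.
move=> /(complex_root_dvd b0); set d := _ + _ => /dvdpP[q pq].
have q0 : q != 0 by apply: contraNneq p0 => q0; rewrite pq q0 mul0r.
apply: (IH q) => //; last first.
  apply: (@jhorner_quadratic_reduce _ _ a b) => //.
  by rewrite -/d mulrA (mulrC d) -pq.
apply: leq_trans sp; rewrite pq size_mul //; last first.
  by apply: contraNneq p0 => d0; rewrite pq d0 mulr0.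
have -> : size d = 3%N.
  rewrite /d size_polyDl ?size_exp_XsubC //.
  by rewrite (leq_ltn_trans (size_polyC_leq1 _)).
by rewrite addn3.
Qed.

End Spectral.

Section Frames.
Context {R : realType} {J : euclideanJordanType R}.
Implicit Types (x y z w c u v : J) (p q g : {poly R}).

Lemma jhorner_congr x (s : seq R) p q : uniq s ->
  jhorner x (\prod_(a <- s) ('X - a%:P)) = 0 ->
  (forall a, a \in s -> p.[a] = q.[a]) -> jhorner x p = jhorner x q.
Proof.
move=> us hs pq; have rs : all (root (p - q)) s.
  by apply/allP => a /pq pqa; rewrite rootE !hornerE pqa subrr.
have [k kE] : exists k, p - q = k * \prod_(a <- s) ('X - a%:P).
  by apply: uniq_roots_prod_XsubC => //; rewrite uniq_rootsE.
have : jhorner x (p - q) = 0 by rewrite kE jhornerM hs jmul0r.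
by rewrite jhornerD jhornerN => /eqP; rewrite subr_eq0 => /eqP.
Qed.

Lemma jhorner_sum x (s : seq R) (F : R -> {poly R}) :
  jhorner x (\sum_(a <- s) F a) = \sum_(a <- s) jhorner x (F a).
Proof.
apply: (big_morph (jhorner x) (jhornerD x)).
by rewrite -(scale0r 0) jhornerZ scale0r.
Qed.

Lemma lagrange_basis (s : seq R) : exists l : R -> {poly R},
  forall a c : R, a \in s -> c \in s -> (l a).[c] = (c == a)%:R.
Proof.
exists (fun a => \prod_(b <- s | b != a) ((a - b)^-1 *: ('X - b%:P))) => a c as_ cs.
rewrite horner_prod; have [->|ca] := eqVneq c a.
  by rewrite big1 // => b ba; rewrite !hornerE mulVf // subr_eq0 eq_sym.
apply/eqP; rewrite prodf_seq_eq0; apply/hasP; exists c => //.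
by rewrite ca /= !hornerE subrr mulr0.
Qed.

(** Lagrange interpolation at the roots of an annihilating polynomial with
    simple real roots; some of the idempotents may vanish. The last clause holds
    because e a is, for a nonzero root a, a polynomial in x without constant
    term. *)
Lemma spectral_idempotents x : exists (s : seq R) (e : R -> J),
  [/\ forall a, a \in s -> jidempotent (e a),
      forall a b, a \in s -> b \in s -> a != b -> jmul (e a) (e b) = 0,
      \sum_(a <- s) e a = junit,
      x = \sum_(a <- s) a *: e a
    & uniq s /\ forall c a, a \in s -> a != 0 -> jidempotent c ->
        jmul c x = x -> jmul c (e a) = e a].
Proof.
have [p p0 px] := jhorner_annihilator x.
have [|s us] := @jhorner_split_annihilator _ _ x p 1 p0.
  by rewrite mulr1.
rewrite mulr1 => hs; have [l lE] := lagrange_basis s.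
have ext := jhorner_congr us hs.
exists s, (fun a => jhorner x (l a)); split.
- move=> a as_; rewrite /jidempotent -jhornerM; apply: ext => c cs.
  by rewrite hornerM lE // -natrM mulnb andbb.
- move=> a b as_ bs ab; rewrite -jhornerM -(scale0r (jhorner x 0)) -jhornerZ.
  apply: ext => c cs; rewrite hornerM !lE // !hornerE.
  case: (eqVneq c a) => [->|]; last by rewrite mul0r.
  by rewrite (negPf ab) mulr0.
- rewrite -jhorner_sum -[RHS]scale1r -(jhornerC x); apply: ext => c cs.
  rewrite horner_sum hornerC (bigD1_seq c) //= lE // eqxx.
  rewrite big_seq_cond big1 ?addr0 // => a /andP[as_ ac].
  by rewrite lE // eq_sym (negPf ac).
- rewrite -[LHS]jhornerX; under eq_bigr do rewrite -jhornerZ.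
  rewrite -(jhorner_sum x s (fun a => a *: l a)); apply: ext => c cs.
  rewrite hornerX horner_sum (bigD1_seq c) //= hornerZ lE // eqxx mulr1.
  rewrite big_seq_cond big1 ?addr0 // => a /andP[as_ ac].
  by rewrite hornerZ lE // eq_sym (negPf ac) mulr0.
split=> // c a as_ a0 cc cx.
have h q : jmul c (jhorner x (q * 'X)) = jhorner x (q * 'X).
  elim/poly_ind: q => [|q k IH].
    by rewrite mul0r jhornerC scale0r jmul0r.
  rewrite mulrDl jhornerD mul_polyC jhornerZ jhornerX jhornerMX jmulDr jmulZr cx.
  by rewrite peirce1_closed.
have : a *: jhorner x (l a) = jhorner x (l a * 'X).
  rewrite -jhornerZ; apply: ext => b bs; rewrite hornerZ hornerMX lE //.
  by case: (eqVneq b a) => [->|]; rewrite ?mul1r ?mulr1 ?mul0r ?mulr0.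
move=> e; have {e} -> : jhorner x (l a) = a^-1 *: jhorner x (l a * 'X).
  by rewrite -e scalerA mulVf // scale1r.
by rewrite jmulZr h.
Qed.

(** The spectral idempotents of x for nonzero eigenvalues split c, so each is 0
    or c. *)
Lemma primitive_peirce1 c x : jprimitive c -> jmul c x = x ->
  exists t, x = t *: c.
Proof.
move=> [c0 cc cprim] cx; have [s [e [ei eo e1 xE [us ce]]]] := spectral_idempotents x.
exists (\sum_(a <- s) if a *: e a == 0 then 0 else a).
rewrite {1}xE scaler_suml big_seq [RHS]big_seq; apply: eq_bigr => a as_.
case: eqP => [->|]; first by rewrite scale0r.
have [->|a0] := eqVneq a 0; first by rewrite scale0r.
move=> ea0; have cea := ce c a as_ a0 cc cx.
have [||||/eqP] := cprim (e a) (c - e a).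
- exact: ei.
- rewrite /jidempotent jmulBl !jmulBr cc cea (ei _ as_) (jmulC (e a)) cea.
  by rewrite subrr subr0.
- by rewrite addrC subrK.
- by move=> ea; case: ea0; rewrite ea scaler0.
by rewrite subr_eq0 => /eqP <-.
Qed.

Definition orth_primitives (cs : seq J) := [/\ uniq cs,
  forall u, u \in cs -> jprimitive u &
  forall u v, u \in cs -> v \in cs -> u != v -> jmul u v = 0].

Lemma orth_primitives_cat cs1 cs2 :
  orth_primitives cs1 -> orth_primitives cs2 ->
  (forall u v, u \in cs1 -> v \in cs2 -> jmul u v = 0) ->
  orth_primitives (cs1 ++ cs2).
Proof.
move=> [u1 p1 o1] [u2 p2 o2] o12; split.
- rewrite cat_uniq u1 u2 andbT; apply/hasPn => v v2; apply/negP => v1.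
  have [v0 vv _] := p2 v v2.
  by move: v0; rewrite -(o12 v v v1 v2) vv eqxx.
- by move=> u; rewrite mem_cat => /orP[/p1|/p2].
move=> u v; rewrite !mem_cat => /orP[hu|hu] /orP[hv|hv] uv; auto.
by rewrite jmulC; auto.
Qed.

(** Splitting an idempotent shrinks its Peirce 1-space strictly, so repeated
    splitting ends with primitive summands. *)
Lemma idempotent_decomposition c : jidempotent c -> exists cs,
  [/\ orth_primitives cs, \sum_(u <- cs) u = c &
      forall u, u \in cs -> jmul c u = u].
Proof.
pose J1 c : {vspace J} := fixedSpace (linfun (jmul c)).
have J1P c' u : reflect (jmul c' u = u) (u \in J1 c').
  by apply: (iffP fixedSpaceP); rewrite lfunE.
have sub u v : jidempotent u -> jmul u v = 0 -> v != 0 -> jidempotent v ->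
    (\dim (J1 u) < \dim (J1 (u + v)%R))%N.
  move=> uu uv v0 vv.
  have s : (J1 u <= J1 (u + v)%R)%VS.
    apply/subvP => x /J1P ux; apply/J1P.
    by rewrite jmulDl ux (peirce1_orth uu uv ux) addr0.
  rewrite ltn_neqAle (dimvS s) andbT; apply/negP => /eqP d.
  have /eqP e : J1 u == J1 (u + v) by rewrite eqEdim s d leqnn.
  have : v \in J1 u by rewrite e; apply/J1P; rewrite jmulDl uv vv add0r.
  by move/J1P; rewrite uv => v0'; rewrite -v0' eqxx in v0.
have [n] := ubnP (\dim (J1 c)); elim: n c => // n IH c /ltnSE cn cc.
have [->|c0] := eqVneq c 0.
  by exists [::]; split=> //; rewrite big_nil.
have [pc|npc] := pselect (jprimitive c).
  exists [:: c]; split.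
  - split=> // [u|u v]; rewrite !inE => /eqP ->//.
    by move=> /eqP ->; rewrite eqxx.
  - by rewrite big_seq1.
  - by move=> u; rewrite inE => /eqP ->.
have [u [v [uu vv uvc u0 v0]]] : exists u v,
    [/\ jidempotent u, jidempotent v, u + v = c, u != 0 & v != 0].
  apply: contrapT => h; apply: npc; split=> // u v uu vv uvc.
  apply: contrapT => h'; apply: h; exists u, v; split=> //.
    by apply/eqP => u0; apply: h'; left.
  by apply/eqP => v0; apply: h'; right.
have uv : jmul u v = 0 by apply: jidempotentD_orth => //; rewrite uvc.
have vu : jmul v u = 0 by rewrite jmulC.
have [||cu [ou su hu]] := IH u; rewrite // .
  by apply: leq_trans cn; rewrite -uvc sub.
have [||cv [ov sv hv]] := IH v; rewrite // .
  by apply: leq_trans cn; rewrite -uvc addrC sub.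
exists (cu ++ cv); split.
- apply: orth_primitives_cat => // a b ai bi.
  rewrite jmulC; have va := peirce1_orth uu uv (hu _ ai).
  by rewrite jmulC (peirce1_orth vv va (hv _ bi)).
- by rewrite big_cat /= su sv.
move=> a; rewrite mem_cat -uvc jmulDl => /orP[ai|ai].
  by rewrite hu // (peirce1_orth uu uv (hu _ ai)) addr0.
by rewrite hv // (peirce1_orth vv vu (hv _ ai)) add0r.
Qed.

(** Each spectral idempotent of x is split into primitive ones; the pairs
    record the eigenvalue along with the idempotent. *)
Lemma primitive_decomposition x : exists S : seq (R * J),
  [/\ orth_primitives (unzip2 S), \sum_(q <- S) q.2 = junit &
      x = \sum_(q <- S) q.1 *: q.2].
Proof.
have [s [e [ei eo e1 xE [us _]]]] := spectral_idempotents x.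
suff [S [oS S1 Sx _]] : exists S : seq (R * J),
    [/\ orth_primitives (unzip2 S), \sum_(q <- S) q.2 = \sum_(a <- s) e a,
      \sum_(q <- S) q.1 *: q.2 = \sum_(a <- s) a *: e a &
      forall u, u \in unzip2 S -> exists2 a, a \in s & jmul (e a) u = u].
  by exists S; split=> //; rewrite ?S1 ?Sx.
move: ei eo us {e1 xE}; elim: s => [|a s IH] ei eo us.
  by exists [::]; split=> //; rewrite !big_nil.
have [|||S [oS S1 Sx Su]] := IH.
- by move=> b bs; apply: ei; rewrite inE bs orbT.
- by move=> b c bs cs; apply: eo; rewrite inE ?bs ?cs orbT.
- by case/andP: us.
have ea := ei a (mem_head _ _).
have [cs [ocs scs hcs]] := idempotent_decomposition ea.
have cs2 : unzip2 [seq (a, u) | u <- cs] = cs by rewrite /unzip2 -map_comp map_id.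
exists ([seq (a, u) | u <- cs] ++ S); split.
- rewrite /unzip2 map_cat -/(unzip2 _) cs2 -/(unzip2 _); apply: orth_primitives_cat => //.
  move=> u v ui vi; have [b bs bv] := Su v vi.
  have ba : b != a by apply: contraTneq us => <-; rewrite /= bs.
  have bs' : b \in a :: s by rewrite inE bs orbT.
  have bu : jmul (e b) u = 0.
    apply: (@peirce1_orth _ _ (e a)) (hcs _ ui) => //.
    by apply: eo; rewrite ?mem_head // eq_sym.
  exact: peirce1_orth (ei _ bs') bu bv.
- by rewrite big_cat big_cons big_map S1 /= scs.
- by rewrite big_cat big_cons big_map Sx /= -scaler_sumr scs.
move=> u; rewrite /unzip2 map_cat mem_cat -!/(unzip2 _) cs2 => /orP[ui|/Su[b bs bu]].
  by exists a; [rewrite mem_head | exact: hcs].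
by exists b => //; rewrite inE bs orbT.
Qed.

Lemma spectrum_exists x : exists s, is_spectrum x s.
Proof.
have [S0 [oS0 S01 S0x]] := primitive_decomposition x.
pose S := sort (relpre fst >=%R) S0.
have pS : perm_eq S S0 by rewrite perm_sort.
have [uS pr oS] : orth_primitives (unzip2 S).
  have p2 : perm_eq (unzip2 S) (unzip2 S0) by apply: perm_map.
  case: oS0 => u p o; split; first by rewrite (perm_uniq p2).
    by move=> v; rewrite (perm_mem p2); apply: p.
  by move=> v w; rewrite !(perm_mem p2); apply: o.
rewrite -(perm_big _ pS) /= in S01; rewrite -(perm_big _ pS) /= in S0x.
have sz : size (unzip1 S) = size S by rewrite size_map.
have sz2 : size (unzip2 S) = size S by rewrite size_map.
exists (unzip1 S); split.
  rewrite sorted_map; apply: sort_sorted => p q; exact: le_total.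
exists (fun i : 'I_(size (unzip1 S)) => (unzip2 S)`_i); last first.
  rewrite {1}S0x (big_nth (0, 0)) big_mkord -sz; apply: eq_bigr => i _.
  by rewrite !(nth_map (0, 0)) // -sz.
split=> [i|i j ij|].
- by apply: pr; rewrite mem_nth // sz2 -sz.
- apply: oS; rewrite ?mem_nth ?sz2 -?sz //.
  by rewrite nth_uniq ?sz2 -?sz.
rewrite -S01 (big_nth (0, 0)) big_mkord -sz; apply: eq_bigr => i _.
by rewrite (nth_map (0, 0)) // -sz.
Qed.

Lemma eigenvaluesP x : is_spectrum x (eigenvalues x).
Proof. by rewrite /eigenvalues; case: xgetP => [s _|h] //; have [s /h] := spectrum_exists x. Qed.

End Frames.

(** * The trace form of the multiplication operators *)

Section MatrixTrace.
Context {F : fieldType}.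

(** In a rank factorization A = C D of an idempotent matrix, D C is an identity
    matrix whose size is the rank. *)
Lemma mxtrace_idempotent n (A : 'M[F]_n) : A *m A = A -> \tr A = (\rank A)%:R.
Proof.
have key r (C : 'M[F]_(n, r)) (D : 'M[F]_(r, n)) : row_full C -> row_free D ->
    C *m D *m (C *m D) = C *m D -> \tr (C *m D) = r%:R.
  move=> /row_fullP[B BC] /row_freeP[B' DB] /(congr1 (fun M => B *m M *m B')).
  rewrite !mulmxA BC !mul1mx -!mulmxA DB mulmx1 => DC.
  by rewrite mxtrace_mulC DC mxtrace1.
move=> AA; rewrite -{1}(mulmx_base A) key ?col_base_full ?row_base_free //.
by rewrite mulmx_base.
Qed.
End MatrixTrace.

Section TraceForm.
Context {R : realType} {J : euclideanJordanType R}.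
Implicit Types (x y z w c u v : J).

Let b := vbasis {:J}.

Definition optrace (f : J -> J) : R := \sum_i coord b i (f b`_i).

Lemma optraceD f g : optrace (fun v => f v + g v) = optrace f + optrace g.
Proof. by rewrite /optrace -big_split; apply: eq_bigr => i _; rewrite linearD. Qed.

Lemma optraceZ t f : optrace (fun v => t *: f v) = t * optrace f.
Proof. by rewrite /optrace mulr_sumr; apply: eq_bigr => i _; rewrite linearZ. Qed.

Lemma optraceB f g : optrace (fun v => f v - g v) = optrace f - optrace g.
Proof. by rewrite /optrace -sumrB; apply: eq_bigr => i _; rewrite linearB. Qed.

Lemma optrace_comp (f g : {linear J -> J}) :
  optrace (fun v => f (g v)) = \sum_(i < \dim {:J}) \sum_(j < \dim {:J})
    coord b j (g b`_i) * coord b i (f b`_j).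
Proof.
apply: eq_bigr => i _; rewrite {1}(coord_vbasis (memvf (g b`_i))) !linear_sum.
by apply: eq_bigr => j _; rewrite !linearZ.
Qed.

Lemma optraceC (f g : {linear J -> J}) :
  optrace (fun v => f (g v)) = optrace (fun v => g (f v)).
Proof.
rewrite !optrace_comp exchange_big; apply: eq_bigr => i _; apply: eq_bigr => j _.
by rewrite mulrC.
Qed.

Lemma optrace_idempotent (f : {linear J -> J}) :
  (forall v, f (f v) = f v) -> 0 <= optrace f /\ (forall v, f v != 0 -> 0 < optrace f).
Proof.
move=> ff; pose A := \matrix_(i < \dim {:J}, j < \dim {:J}) coord b j (f b`_i).
have AA : A *m A = A.
  apply/matrixP => i k; rewrite !mxE -[in RHS]ff.
  rewrite [in RHS](coord_vbasis (memvf (f b`_i))) !linear_sum.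
  by apply: eq_bigr => j _; rewrite !mxE !linearZ.
have -> : optrace f = (\rank A)%:R.
  by rewrite -mxtrace_idempotent //; apply: eq_bigr => i _; rewrite mxE.
split=> [|v fv]; first exact: ler0n.
rewrite ltr0n lt0n mxrank_eq0; apply: contraNneq fv => A0.
rewrite (coord_vbasis (memvf v)) linear_sum big1 // => i _.
rewrite linearZ /= (coord_vbasis (memvf (f b`_i))) big1 ?scaler0 // => j _.
by have := congr1 (fun M => fun_of_matrix M i j) A0; rewrite !mxE => ->; rewrite scale0r.
Qed.

(** Bilinearity and associativity of this form come from operator traces. It
    differs from the inner product of J by a weight on each simple ideal. *)
Definition trform x y := optrace (jmul (jmul x y)).

Let optrace_jmul a c w : optrace (jmul (jmul (jmul c a) w)) =
  optrace (fun v => jmul (jmul a w) (jmul c v)) +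
  optrace (fun v => jmul (jmul c a) (jmul w v)) +
  optrace (fun v => jmul (jmul c w) (jmul a v)) -
  optrace (fun v => jmul a (jmul w (jmul c v))) -
  optrace (fun v => jmul c (jmul w (jmul a v))).
Proof.
rewrite -!optraceD -!optraceB; congr optrace; apply: funext => v.
have := jordan_linearized a v c w.
rewrite (jmulC v c) (jmulC (jmul c v) w) (jmulC (jmul a v) w).
rewrite (jmulC v (jmul (jmul c a) w)) (jmulC (jmul c v) (jmul a w)) (jmulC v w).
rewrite (jmulC (jmul a v) (jmul c w)) => h.
by apply: jext => f; have := congr1 f h; rewrite !scalE; lra.
Qed.

(** Cyclicity of the trace cancels the non-symmetric terms of the linearized
    Jordan identity. *)
Lemma trformA x y z : trform (jmul x y) z = trform x (jmul y z).
Proof.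
rewrite /trform (jmulC x (jmul y z)) (jmulC y z) !optrace_jmul.
have e1 : optrace (fun v => jmul y (jmul z (jmul x v)))
    = optrace (fun v => jmul z (jmul x (jmul y v))) := optraceC (jmul y) (jmul z \o jmul x).
have e2 : optrace (fun v => jmul x (jmul z (jmul y v)))
    = optrace (fun v => jmul y (jmul x (jmul z v))) := optraceC (jmul x \o jmul z) (jmul y).
have e3 : optrace (fun v => jmul (jmul y z) (jmul x v))
    = optrace (fun v => jmul x (jmul (jmul y z) v)) := optraceC (jmul (jmul y z)) (jmul x).
rewrite (jmulC y x) (jmulC z y) (jmulC z x); lra.
Qed.

Lemma trformC x y : trform x y = trform y x.
Proof. by rewrite /trform jmulC. Qed.

Lemma trformD x y z : trform (x + y) z = trform x z + trform y z.
Proof. by rewrite /trform -optraceD; congr optrace; apply: funext => v; rewrite !jmulDl. Qed.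

Lemma trformZ t x z : trform (t *: x) z = t * trform x z.
Proof. by rewrite /trform -optraceZ; congr optrace; apply: funext => v; rewrite !jmulZl. Qed.

(** The relation says that L is diagonalizable with eigenvalues in 0, 1/2 and 1;
    the two projections below are those on the last two eigenspaces. *)
Lemma optrace_peirce_gt0 (L : {linear J -> J}) c :
  (forall v, 2 *: L (L (L v)) + L v = 3 *: L (L v)) -> c != 0 -> L c = c ->
  0 < optrace L.
Proof.
move=> pc c0 cc.
have [E1 E1E] : exists f : {linear J -> J}, forall v, f v = 2 *: L (L v) - L v.
  by exists ((2 \*: (L \o L)) \- L).
have [Eh EhE] : exists f : {linear J -> J},
    forall v, f v = 4 *: (L v - L (L v)).
  by exists (4 \*: (L \- (L \o L))).
have E11 v : E1 (E1 v) = E1 v.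
  rewrite !E1E !(linearB, linearZ) /=; apply: jext => f.
  have := congr1 f (pc v); have := congr1 f (pc (L v)).
  by rewrite !scalE; lra.
have Ehh v : Eh (Eh v) = Eh v.
  rewrite !EhE !(linearB, linearZ) /= !linearB /=; apply: jext => f.
  have := congr1 f (pc v); have := congr1 f (pc (L v)).
  by rewrite !scalE; lra.
have -> : optrace L = optrace E1 + 2^-1 * optrace Eh.
  rewrite -optraceZ -optraceD; congr optrace; apply: funext => v.
  by rewrite E1E EhE; apply: jext => f; rewrite !scalE; lra.
have [_ /(_ c) h1] := optrace_idempotent E11.
have [h2 _] := optrace_idempotent Ehh.
have : 0 < optrace E1.
  by apply: h1; rewrite E1E !cc scaler_nat mulr2n addrK.
lra.
Qed.

Lemma trform_idempotent_gt0 c : jidempotent c -> c != 0 -> 0 < trform c c.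
Proof.
move=> cc c0; rewrite /trform cc.
exact: (@optrace_peirce_gt0 (jmul c) c (fun v => jmul_peirce v cc) c0 cc).
Qed.

Lemma frame_sqr n (c : 'I_n -> J) (s : 'I_n -> R) : jordan_frame c ->
  jmul (\sum_i s i *: c i) (\sum_i s i *: c i) = \sum_i (s i) ^+ 2 *: c i.
Proof.
move=> [pc oc _]; rewrite jmul_suml; apply: eq_bigr => i _.
rewrite jmul_sumr (bigD1 i) //= big1 => [|j ji].
  by case: (pc i) => _ cc _; rewrite addr0 jmulZl jmulZr cc scalerA.
by rewrite jmulZl jmulZr oc ?scaler0 // eq_sym.
Qed.

Lemma trform_suml (I : Type) (r : seq I) (P : pred I) (F : I -> J) z :
  trform (\sum_(i <- r | P i) F i) z = \sum_(i <- r | P i) trform (F i) z.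
Proof.
apply: (big_morph (trform^~ z) (fun x y => trformD x y z)).
by rewrite -(scale0r z) trformZ mul0r.
Qed.

Lemma spectral_frame x : exists n (c : 'I_n -> J) (s : 'I_n -> R),
  jordan_frame c /\ x = \sum_i s i *: c i.
Proof.
have [_ [c fc xE]] := eigenvaluesP x.
by exists (size (eigenvalues x)), c, (fun i => (eigenvalues x)`_i).
Qed.

(** In a spectral decomposition, the form at x is the sum of the squared
    eigenvalues, weighted by the positive traces of idempotents. *)
Lemma trform_def x : 0 <= trform x x /\ (trform x x = 0 -> x = 0).
Proof.
have [n [c [s [fc ->]]]] := spectral_frame x.
have -> : trform (\sum_i s i *: c i) (\sum_i s i *: c i)
    = \sum_i (s i) ^+ 2 * trform (c i) (c i).
  rewrite /trform frame_sqr // -[LHS]/(optrace (jmul _)) -[X in jmul X]jmulr1.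
  rewrite -[LHS]/(trform _ _) trform_suml; apply: eq_bigr => i _.
  case: fc => /(_ i) [_ cc _] _ _.
  by rewrite trformZ /trform cc jmulr1.
have tc i : 0 < trform (c i) (c i).
  by case: fc => /(_ i) [c0 cc _] _ _; apply: trform_idempotent_gt0.
split; first by apply: sumr_ge0 => i _; rewrite mulr_ge0 ?sqr_ge0 // ltW.
move=> h; apply: big1 => i _.
have : s i ^+ 2 * trform (c i) (c i) == 0.
  move/eqP: h; rewrite psumr_eq0 => [/allP|j _]; last by rewrite mulr_ge0 ?sqr_ge0 // ltW.
  by apply; rewrite mem_index_enum.
by rewrite mulf_eq0 (gt_eqF (tc i)) orbF sqrf_eq0 => /eqP ->; rewrite scale0r.
Qed.

End TraceForm.

(** * Associative inner products and primitive idempotents *)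

(** A positive definite symmetric bilinear form for which every multiplication
    is self-adjoint. *)
Record associative_inner_product {R : realType} {J : euclideanJordanType R}
    (b : J -> J -> R) : Prop := AssociativeInnerProduct {
  aipC : forall x y, b x y = b y x ;
  aipD : forall x y z, b (x + y) z = b x z + b y z ;
  aipZ : forall t x z, b (t *: x) z = t * b x z ;
  aipA : forall x y z, b (jmul x y) z = b x (jmul y z) ;
  aip_ge0 : forall x, 0 <= b x x ;
  aip_eq0 : forall x, b x x = 0 -> x = 0
}.

Section InnerProduct.
Context {R : realType} {J : euclideanJordanType R} (b : J -> J -> R).
Context (hb : associative_inner_product b).
Implicit Types (x y z w c u v : J).

Lemma aipDr x y z : b z (x + y) = b z x + b z y.
Proof. by rewrite !(aipC hb z) (aipD hb). Qed.
Lemma aipZr t x z : b z (t *: x) = t * b z x.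
Proof. by rewrite !(aipC hb z) (aipZ hb). Qed.
Lemma aipN x z : b (- x) z = - b x z.
Proof. by rewrite -scaleN1r (aipZ hb) mulN1r. Qed.
Lemma aipNr x z : b z (- x) = - b z x.
Proof. by rewrite !(aipC hb z) aipN. Qed.
Lemma aip0 z : b 0 z = 0.
Proof. by rewrite -(scale0r z) (aipZ hb) mul0r. Qed.
Lemma aip0r z : b z 0 = 0.
Proof. by rewrite (aipC hb) aip0. Qed.
Lemma aip_suml (I : Type) (r : seq I) (P : pred I) (F : I -> J) z :
  b (\sum_(i <- r | P i) F i) z = \sum_(i <- r | P i) b (F i) z.
Proof. exact: (big_morph (b^~ z) (fun x y => aipD hb x y z) (aip0 z)). Qed.
Definition aipE := (aipD hb, aipDr, aipN, aipNr, aipZ hb, aipZr).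

Lemma aip_selfadjoint c u v : b (jmul c u) v = b u (jmul c v).
Proof. by rewrite jmulC (aipA hb). Qed.

(** Both components of u in the Peirce spaces of c for the eigenvalues 1 and 1/2
    contribute a square to this value. *)
Lemma aip_idempotent c u : jidempotent c ->
  0 <= b (jmul c u) u /\ (b (jmul c u) u = 0 -> jmul c u = 0).
Proof.
move=> cc; have pc := jmul_peirce u cc.
have [u1 u1E] : exists v,
    v = 2 *: jmul c (jmul c u) - jmul c u by exists (2 *: jmul c (jmul c u) - jmul c u).
have [uh uhE] : exists v,
    v = 4 *: (jmul c u - jmul c (jmul c u)) by exists (4 *: (jmul c u - jmul c (jmul c u))).
have cu1 : jmul c u1 = u1.
  rewrite u1E jmulBr jmulZr; apply: jext => f; have := congr1 f pc.
  by rewrite !scalE; lra.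
have cuh : jmul c uh = 2^-1 *: uh.
  rewrite uhE !(jmulBr, jmulZr); apply: jext => f; have := congr1 f pc.
  by rewrite !scalE; lra.
have cu : jmul c u = u1 + 2^-1 *: uh.
  by rewrite u1E uhE; apply: jext => f; rewrite !scalE; lra.
have b1 : b u1 u = b u1 u1.
  by have := congr1 (b u1) u1E; rewrite !aipE -!aip_selfadjoint !cu1; lra.
have bh : b uh u = b uh uh.
  have := congr1 (b uh) uhE; rewrite !aipE -!aip_selfadjoint.
  by rewrite !(cuh, jmulZr, aipE); lra.
rewrite {1 2}cu !aipE b1 bh.
have := aip_ge0 hb u1; have := aip_ge0 hb uh => h1 h2.
split; first lra.
move=> h; have u10 : u1 = 0 by apply: (aip_eq0 hb); lra.
have uh0 : uh = 0 by apply: (aip_eq0 hb); lra.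
by rewrite cu u10 uh0 scaler0 addr0.
Qed.

Lemma primitive_aip_gt0 c : jprimitive c -> 0 < b c c.
Proof.
move=> [c0 _ _]; rewrite lt_def (aip_ge0 hb) andbT.
by apply: contraNneq c0 => /(aip_eq0 hb) ->.
Qed.

Lemma primitive_aip_eq0 c u : jprimitive c -> jprimitive u -> b c u = 0 ->
  jmul c u = 0.
Proof.
move=> [_ cc _] [_ uu _] cu0; have [_] := aip_idempotent u cc; apply.
by rewrite (aipA hb) uu.
Qed.

(** Compression of u by c is a multiple of c, the factor being both
    b c u / b c c and, by pairing with u, a quantity symmetric in c and u. *)
Lemma primitive_aip_eq c u : jprimitive c -> jprimitive u ->
  b c u <> 0 -> b c c = b u u.
Proof.
have aux p q : jprimitive p -> jprimitive q ->
    (b p q / b p p) * b p q = 2 * b (jmul p q) (jmul p q) - b p q.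
  move=> pp [_ qq _]; have := primitive_aip_gt0 pp; case: (pp) => _ cc _ bp.
  have [t tE] : exists t, 2 *: jmul p (jmul p q) - jmul p q = t *: p.
    apply: primitive_peirce1 => //; have := jmul_peirce q cc.
    rewrite jmulBr jmulZr => h; apply: jext => f; have := congr1 f h.
    by rewrite !scalE; lra.
  have e1 : t * b p p = b p q.
    have := congr1 (b p) tE; rewrite !aipE -!aip_selfadjoint !cc; lra.
  have e2 : t * b p q = 2 * b (jmul p q) (jmul p q) - b p q.
    have := congr1 (b q) tE; rewrite !aipE -!aip_selfadjoint.
    rewrite (aipC hb q p) (jmulC p q) (aipA hb p) ?(aipA hb q p q).
    by rewrite (aipC hb q (jmul p q)) (aipA hb) qq; lra.
  by rewrite -e2 -e1 mulfK ?gt_eqF.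
move=> pc pu /eqP cu0; have := aux _ _ pc pu; have := aux _ _ pu pc.
rewrite (aipC hb u c) (jmulC u c) => <- /(mulIf cu0) /(mulfI cu0) /invr_inj.
by move=> ->.
Qed.

End InnerProduct.

(** * The Jordan trace and its inner product *)

Section JordanTrace.
Context {R : realType} {J : euclideanJordanType R}.
Implicit Types (x y z w c u v : J).

Lemma trform_aip : associative_inner_product (@trform R J).
Proof.
split.
- exact: trformC.
- exact: trformD.
- exact: trformZ.
- exact: trformA.
- by move=> x; have [] := trform_def x.
- by move=> x; have [_] := trform_def x.
Qed.

Let hB := trform_aip.

(** The weight of a primitive idempotent is the trace of its multiplication
    operator. Weights are equal for primitive idempotents that are not
    orthogonal, so the sum w of the elements of a frame divided by their weights
    satisfies u w = t^-1 u for every primitive idempotent u of weight t. This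
    normalizes the trace, and also makes w central enough for associativity. *)
Lemma trace_density : exists w : J,
  (forall c, jprimitive c -> trform c w = 1) /\
  (forall x y z, trform (jmul (jmul x y) z) w = trform (jmul x (jmul y z)) w).
Proof.
have [n [c [s [[pc oc c1] _]]]] := spectral_frame (0 : J).
pose t u : R := trform u u.
exists (\sum_i (t (c i))^-1 *: c i); set w := \sum_i _.
have uw u : jprimitive u -> jmul u w = (t u)^-1 *: u.
  move=> pu; transitivity ((t u)^-1 *: jmul u (\sum_i c i)); last first.
    by rewrite c1 jmulr1.
  rewrite !jmul_sumr scaler_sumr.
  apply: eq_bigr => i _; rewrite jmulZr.
  have [ci0|/eqP ci] := eqVneq (trform u (c i)) 0.
    by rewrite (primitive_aip_eq0 hB pu (pc i) ci0) !scaler0.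
  have e : t u = t (c i) := primitive_aip_eq hB pu (pc i) ci.
  by rewrite e.
have tn0 u : jprimitive u -> t u != 0.
  by move=> pu; rewrite gt_eqF // (primitive_aip_gt0 hB).
split=> [u pu|x y z].
  have [_ uu _] := pu; rewrite -{1}uu (aipA hB) uw // (aipZr hB) -/(t u).
  by rewrite mulVf ?tn0.
have [n1 [p [a [[pp _ _] ->]]]] := spectral_frame x.
have [n2 [q [b [[pq _ _] ->]]]] := spectral_frame z.
rewrite !jmul_suml !(aip_suml hB); apply: eq_bigr => i _.
rewrite !jmul_sumr !(aipC hB _ w) !(aipC hB w) !(aip_suml hB).
apply: eq_bigr => j _; rewrite !(jmulZl, jmulZr) !(aipZ hB).
rewrite mulrCA; congr (_ * (_ * _)).
have -> : trform (jmul (jmul (p i) y) (q j)) w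
    = (t (q j))^-1 * trform (p i) (jmul y (q j)).
  by rewrite (aipA hB) uw // (aipZr hB) (aipA hB).
have -> : trform (jmul (p i) (jmul y (q j))) w
    = (t (p i))^-1 * trform (p i) (jmul y (q j)).
  by rewrite jmulC (aipA hB) uw // (aipZr hB) (aipC hB _ (p i)).
have [pq0|/eqP pq0] := eqVneq (trform (p i) (q j)) 0; last first.
  have e : t (p i) = t (q j) := primitive_aip_eq hB (pp i) (pq j) pq0.
  by rewrite e.
rewrite (jmulC y) -(aipA hB) (primitive_aip_eq0 hB (pp i) (pq j) pq0).
by rewrite (aip0 hB) !mulr0.
Qed.

(** The sum of the eigenvalues is read off from any spectral decomposition by a
    functional equal to 1 on primitive idempotents. *)
Lemma jtr_linear_form : exists T : J -> R,
  [/\ forall x, jtr x = T x, forall x y, T (x + y) = T x + T y,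
      forall t x, T (t *: x) = t * T x,
      forall c, jprimitive c -> T c = 1 &
      forall x y z, T (jmul (jmul x y) z) = T (jmul x (jmul y z))].
Proof.
have [w [w1 wA]] := trace_density; exists (trform^~ w); split=> //.
- move=> x; have [_ [c [pc _ _] xE]] := eigenvaluesP x.
  rewrite {2}xE (aip_suml hB) /jtr (big_nth 0) big_mkord.
  by apply: eq_bigr => i _; rewrite (aipZ hB) w1 ?mulr1.
- by move=> x y; rewrite (aipD hB).
- by move=> t x; rewrite (aipZ hB).
Qed.

Lemma jdot_aip : associative_inner_product (@jdot R J).
Proof.
have [T [TE TD TZ T1 TA]] := jtr_linear_form.
have sq x : exists n (c : 'I_n -> J) (s : 'I_n -> R),
    [/\ x = \sum_i s i *: c i & jdot x x = \sum_i s i ^+ 2].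
  have [n [c [s [fc xE]]]] := spectral_frame x; exists n, c, s; split=> //.
  rewrite /jdot TE xE frame_sqr // (big_morph T TD (id1 := 0)); last first.
    by rewrite -(scale0r 0) TZ mul0r.
  by apply: eq_bigr => i _; rewrite TZ T1 ?mulr1 //; case: fc => /(_ i).
split; rewrite /jdot.
- by move=> x y; rewrite jmulC.
- by move=> x y z; rewrite !TE jmulDl TD.
- by move=> t x z; rewrite !TE jmulZl TZ.
- by move=> x y z; rewrite !TE TA.
- move=> x; rewrite -/(jdot x x); have [n [c [s [_ ->]]]] := sq x.
  by apply: sumr_ge0 => i _; apply: sqr_ge0.
move=> x; rewrite -/(jdot x x); have [n [c [s [xE ->]]]] := sq x => /eqP; rewrite xE.
rewrite psumr_eq0 => [/allP h|i _]; last exact: sqr_ge0.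
apply: big1 => i _; have := h i (mem_index_enum _).
by rewrite sqrf_eq0 => /eqP ->; rewrite scale0r.
Qed.

(** Squares expand as nonnegative combinations of idempotents, and multiplication
    by an idempotent is positive semidefinite. *)
Lemma jdot_cone_ge0 x y : jcone x -> jcone y -> 0 <= jdot x y.
Proof.
have hD := jdot_aip.
move=> [u ->] [v ->]; have [n [c [s [fc vE]]]] := spectral_frame v.
rewrite vE frame_sqr // (aipC hD) (aip_suml hD); apply: sumr_ge0 => i _.
have [_ cc _] : jprimitive (c i) by case: fc.
rewrite (aipZ hD) mulr_ge0 ?sqr_ge0 // -(aipA hD).
by case: (aip_idempotent hD u cc).
Qed.

Lemma jdot_ge0 x : 0 <= jdot x x. Proof. exact: aip_ge0 jdot_aip x. Qed.

Lemma jnorm_sqr x : jnorm x ^+ 2 = jdot x x.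
Proof. by rewrite sqr_sqrtr // jdot_ge0. Qed.

Lemma jnorm_ge0 x : 0 <= jnorm x. Proof. exact: sqrtr_ge0. Qed.

Lemma jnorm_gt0 x : x != 0 -> 0 < jnorm x.
Proof.
move=> x0; rewrite lt_def jnorm_ge0 andbT; apply: contraNneq x0 => x0.
by apply/eqP; apply: (aip_eq0 jdot_aip); rewrite -jnorm_sqr x0 expr0n.
Qed.

Lemma jnormZ t x : jnorm (t *: x) = `|t| * jnorm x.
Proof.
rewrite /jnorm (aipZ jdot_aip) (aipZr jdot_aip) mulrA -expr2.
by rewrite sqrtrM ?sqr_ge0 // sqrtr_sqr.
Qed.

Lemma jinterior_sub (C : set J) x : jinterior C x -> C x.
Proof.
move=> [e e0]; apply.
by rewrite subrr -[0 : J](scale0r 0) jnormZ normr0 mul0r.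
Qed.

(** Pairing with an interior point of the self-dual cone bounds the norm on the
    cone. *)
Lemma jnorm_le_interior a : jinterior jcone a ->
  exists2 C : R, 0 < C & forall y, jcone y -> jnorm y <= C * jdot a y.
Proof.
move=> [e e0 ae]; exists (2 / e); first by rewrite divr_gt0.
move=> y cy; have [->|y0] := eqVneq y 0.
  by rewrite (aip0r jdot_aip) mulr0 -[0 : J](scale0r 0) jnormZ normr0 mul0r.
have ny := jnorm_gt0 y0; pose v := a - (e / 2 / jnorm y) *: y.
have cv : jcone v.
  apply: ae; rewrite /v addrC addKr -scaleNr jnormZ normrN ger0_norm; last first.
    by rewrite !divr_ge0 // ltW.
  rewrite mulfVK ?gt_eqF //; lra.
have := jdot_cone_ge0 cv cy; rewrite /v (aipD jdot_aip) (aipN jdot_aip).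
rewrite (aipZ jdot_aip) -jnorm_sqr expr2 mulrA mulfVK ?gt_eqF // => h.
have -> : 2 / e * jdot a y = (e / 2)^-1 * jdot a y by rewrite invf_div.
by rewrite ler_pdivlMl ?divr_gt0 //; lra.
Qed.

Lemma jdot_weighted_young (s : R) x y : 0 < s ->
  jdot x y <= s / 2 * jnorm x ^+ 2 + (2 * s)^-1 * jnorm y ^+ 2.
Proof.
move=> s0; have := jdot_ge0 (s *: x - y).
rewrite !jnorm_sqr !(aipE jdot_aip) (aipC jdot_aip y x) => h.
rewrite -(@ler_pM2l _ (2 * s)) ?mulr_gt0 // mulrDr.
rewrite [X in _ <= _ + X]mulrA mulfV ?gt_eqF ?mulr_gt0 // mul1r.
by lra.
Qed.

Lemma jdot_le_jnorm x y : jdot x y <= jnorm x * jnorm y.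
Proof.
have [->|/jnorm_gt0 nx] := eqVneq x 0.
  by rewrite (aip0 jdot_aip) mulr_ge0 // jnorm_ge0.
have [->|/jnorm_gt0 ny] := eqVneq y 0.
  by rewrite (aip0r jdot_aip) mulr_ge0 // jnorm_ge0.
have := jdot_weighted_young x y (divr_gt0 ny nx); set r := (X in _ <= X).
suff -> : r = jnorm x * jnorm y by [].
by rewrite /r; field; rewrite !gt_eqF.
Qed.

End JordanTrace.

(** * Riesz representation *)

Section Hilbert.
Context {R : realType} {X : hilbertType R}.
Implicit Types (x y z u v w h : X).
Local Open Scope classical_set_scope.

Lemma hdotC x y : hdot x y = hdot y x.
Proof.
have := hermitian_subproof (s := hdot (s := X)) x y.
by rewrite expr0 mul1r.
Qed.
Lemma hdotD x y z : hdot (x + y) z = hdot x z + hdot y z.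
Proof. exact: linearDl. Qed.
Lemma hdotN x z : hdot (- x) z = - hdot x z.
Proof. exact: linearNl. Qed.
Lemma hdotZ t x z : hdot (t *: x) z = t * hdot x z.
Proof. exact: linearZl_LR. Qed.
Lemma hdotDr x y z : hdot z (x + y) = hdot z x + hdot z y.
Proof. by rewrite !(hdotC z) hdotD. Qed.
Lemma hdotNr x z : hdot z (- x) = - hdot z x.
Proof. by rewrite !(hdotC z) hdotN. Qed.
Lemma hdotZr t x z : hdot z (t *: x) = t * hdot z x.
Proof. by rewrite !(hdotC z) hdotZ. Qed.
Definition hdotE := (hdotD, hdotDr, hdotN, hdotNr, hdotZ, hdotZr).

Lemma hdot_weighted_young (s : R) x y : 0 < s ->
  hdot x y <= s / 2 * `|x| ^+ 2 + (2 * s)^-1 * `|y| ^+ 2.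
Proof.
move=> s0; have := sqr_ge0 `|s *: x - y|.
rewrite -!hdot_norm !hdotE (hdotC y x) => h.
rewrite -(@ler_pM2l _ (2 * s)) ?mulr_gt0 // mulrDr.
rewrite [X in _ <= _ + X]mulrA mulfV ?gt_eqF ?mulr_gt0 // mul1r.
by lra.
Qed.

(** A minimizing sequence of half the squared norm minus the functional is
    Cauchy by the parallelogram law, and its limit represents the functional. *)
Lemma riesz_representation (f : X -> R) (C : R) :
  (forall x y, f (x + y) = f x + f y) -> (forall t x, f (t *: x) = t * f x) ->
  (forall w, f w <= C * `|w|) -> exists u, forall w, f w = hdot w u.
Proof.
move=> fD fZ fC; pose F w : R := `|w| ^+ 2 / 2 - f w.
have F_lb : has_lbound (range F).
  exists (- (C ^+ 2 / 2)) => _ [w _ <-]; rewrite /F.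
  have := fC w; have := sqr_ge0 (`|w| - C); rewrite sqrrB mulr2n; nra.
have F_inf : has_inf (range F) by split=> //; exists (F 0), 0.
pose m : R := inf (range F).
have mF w : m <= F w by apply: ge_inf => //; exists w.
have /choice[w wE] : forall n, exists w, F w < m + n.+1%:R^-1.
  move=> n; have [//|_ [w _ <-] hw] := @inf_adherent _ (range F) n.+1%:R^-1 _ F_inf.
  by exists w.
have par x y : `|x - y| ^+ 2 <= 4 * (F x + F y - 2 * m).
  have := mF (2^-1 *: (x + y)); rewrite /F -!hdot_norm fZ fD !hdotE (hdotC y x).
  by move: (f x) (f y) => fx fy; lra.
have /cvg_ex[/= u wu] : cvg (w @ \oo).
  apply: cauchy_cvg; apply/cauchyP => e e0.
  have [N _ hN] := near_infty_natSinv_lt (PosNum (divr_gt0 (exprn_gt0 2 e0) (ltr0n R 8))).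
  exists (w N), N => // n /= Nn; rewrite -ball_normE /= -(@ltr_pXn2r _ 2) ?nnegrE ?(ltW e0) //.
  have := par (w N) (w n); have := wE N; have := wE n.
  have := hN _ Nn; have := hN _ (leqnn N); rewrite /= => h1 h2 h3 h4 h5.
  apply: le_lt_trans h5 _; move: h1 h2 h3 h4.
  by move: (n.+1%:R^-1) (N.+1%:R^-1) => p q h1 h2 h3 h4; lra.
exists u => h.
have small t : 0 <= t * (hdot h u - f h) + t ^+ 2 * `|h| ^+ 2 / 2.
  rewrite leNgt; apply/negP; set P := (X in X < 0) => P0.
  have q0 : 0 <= t ^+ 2 * `|h| ^+ 2 by rewrite mulr_ge0 ?sqr_ge0.
  pose c : R := 3 / 2 + t ^+ 2 * `|h| ^+ 2 / 2.
  have c0 : 0 < c by rewrite /c; lra.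
  (* near the limit, P >= - e * c; with this e the right-hand side is P / 2 *)
  pose e : R := - P / (2 * c).
  have e0 : 0 < e by rewrite divr_gt0 ?mulr_gt0 // oppr_gt0.
  have ec : e * c = - P / 2 by rewrite /e; field; rewrite gt_eqF.
  have /cvgrPdist_lt/(_ e e0) near_u := wu.
  have near_inv := near_infty_natSinv_lt (PosNum e0).
  have [n [n_u n_inv]] : exists n, `|u - w n| < e /\ n.+1%:R^-1 < e.
    have : \forall n \near \oo, `|u - w n| < e /\ n.+1%:R^-1 < e.
      by near=> n; split; near: n.
    by case=> N _ /(_ N (leqnn N)); exists N.
  have nu2 : `|w n - u| ^+ 2 <= e ^+ 2.
    by rewrite lerXn2r ?nnegrE ?(ltW e0) // distrC ltW.
  have en0 : 0 < e^-1 by rewrite invr_gt0.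
  have := hdot_weighted_young (w n - u) (t *: h) en0.
  have -> : (2 * e^-1)^-1 = e / 2 by field; rewrite gt_eqF.
  have : e^-1 / 2 * `|w n - u| ^+ 2 <= e / 2.
    have -> : e / 2 = e^-1 / 2 * e ^+ 2 by field; rewrite gt_eqF.
    by rewrite ler_pM2l // divr_gt0.
  have := mF (w n + t *: h); have := lt_trans (wE n) (_ : _ < m + e).
  rewrite ltrD2l => /(_ n_inv); move: P0 ec.
  rewrite /F /P /c normrZ exprMn real_normK ?num_real // -!hdot_norm fD fZ.
  rewrite !hdotE (hdotC h (w n)) (hdotC h u).
  lra.
(* the minimizer of the quadratic small, but for the 1 that covers h = 0 *)
have := small (- (hdot h u - f h) / (`|h| ^+ 2 + 1)).
have h0 : 0 <= `|h| ^+ 2 by rewrite sqr_ge0.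
set D := hdot h u - f h; set q := `|h| ^+ 2 in h0 *.
have -> : - D / (q + 1) * D + (- D / (q + 1)) ^+ 2 * q / 2
   = - (D ^+ 2 * ((q + 2) / (2 * (q + 1) ^+ 2))).
  by field; rewrite gt_eqF //; lra.
rewrite oppr_ge0 pmulr_lle0; last first.
  by rewrite divr_gt0 ?mulr_gt0 ?exprn_gt0 //; lra.
move=> D0; have : D ^+ 2 == 0 by rewrite eq_le D0 sqr_ge0.
by rewrite sqrf_eq0 subr_eq0 => /eqP.
Unshelve. all: by end_near. Qed.

End Hilbert.

(** * Adjoints, strong convexity and growth of the weights *)

Section Adjoints.
Context {R : realType} {X : hilbertType R} {J : euclideanJordanType R}.

Lemma adjKP (K : {linear X -> J}) w y : bounded_operator K ->
  jdot (K w) y = hdot w (adjK K y).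
Proof.
move=> [M KM]; have hD := @jdot_aip R J.
have [|||u uP] := @riesz_representation R X (fun w => jdot (K w) y) (M * jnorm y).
- by move=> u v; rewrite linearD (aipD hD).
- by move=> t u; rewrite linearZ (aipZ hD).
- move=> v; apply: le_trans (jdot_le_jnorm _ _) _.
  by rewrite mulrAC ler_wpM2r ?jnorm_ge0.
have h : exists u, [set u | forall v, jdot (K v) y = hdot v u]%classic u by exists u.
by rewrite /adjK /adjoint; case: xgetP => [u' _ ->//|/(_ u)]; case.
Qed.

(** Where the adjoint does not exist it is 0, which is orthogonal to v too. *)
Lemma jdot_adjA_eq0 k (A : {linear J -> 'cV[R]_k}) v z :
  A v = 0 -> jdot v (adjA A z) = 0.
Proof.
move=> Av; rewrite /adjA /adjoint; case: xgetP => [u _ <-|_].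
  by rewrite Av /cdot big1 // => i _; rewrite mxE mul0r.
by rewrite (aip0r jdot_aip).
Qed.

(** Boundedness makes the supremum that defines the norm a genuine upper bound. *)
Lemma opnorm_gt0 (K : {linear X -> J}) :
  bounded_operator K -> (exists v, K v != 0) -> 0 < opnorm K.
Proof.
move=> [M KM] [v Kv]; have v0 : 0 < `|v|.
  by rewrite normr_gt0; apply: contraNneq Kv => ->; rewrite linear0.
have h : 0 < jnorm (K (`|v|^-1 *: v)).
  by rewrite linearZ jnormZ mulr_gt0 ?jnorm_gt0 // normr_gt0 invr_eq0 gt_eqF.
apply: lt_le_trans h _; apply: ub_le_sup.
  exists `|M| => _ [x /= x1 <-]; apply: le_trans (KM x) _.
  apply: le_trans (ler_wpM2r (normr_ge0 x) (ler_norm M)) _.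
  by rewrite ler_piMr.
exists (`|v|^-1 *: v) => //=.
by rewrite normrZ normfV normr_id mulVf ?gt_eqF.
Qed.

End Adjoints.

Section StrongConvexity.
Context {R : realType} {X : hilbertType R}.
Context (G : X -> \bar R) (gamma : R).
Context (properG : eproper G) (convG : strongly_convex G gamma).

Lemma subdifferential_fin x g : subdifferential G x g -> exists r, G x = r%:E.
Proof.
move=> xg; have [Gny [v Gv]] := properG; have := xg v; have := Gny x.
case: (G x) => [r||] //= _; first by exists r.
by rewrite addye // leNgt Gv.
Qed.

(** The subgradient inequality is compared with convexity at t v + (1 - t) x,
    divided by t, and t tends to 0. *)
Lemma strong_subgradient x g v r s : subdifferential G x g ->
  G x = r%:E -> G v = s%:E ->
  r + hdot g (v - x) + gamma / 2 * `|v - x| ^+ 2 <= s.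
Proof.
move=> xg Gx Gv.
have aux t : 0 < t < 1 ->
    r + hdot g (v - x) + gamma / 2 * (1 - t) * `|v - x| ^+ 2 <= s.
  move=> /andP[t0 t1].
  have := convG v x (introT andP (conj t0 t1)); rewrite Gx Gv.
  have := xg (t *: v + (1 - t) *: x); rewrite Gx.
  have [Gny _] := properG; have := Gny (t *: v + (1 - t) *: x).
  case: (G _) => [p||] // _; rewrite -?EFinD ?lee_fin => h1.
    have e : t *: v + (1 - t) *: x - x = t *: (v - x).
      by rewrite scalerBl scale1r scalerBr addrA addrAC addrK.
    rewrite e in h1.
    move=> h2; rewrite -(ler_pM2l t0); move: h1 h2; rewrite -!hdot_norm !hdotE (hdotC x v).
    lra.
rewrite leNgt; apply/negP; set b := gamma / 2 * _ => h.
pose d := r + hdot g (v - x) + b - s.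
have d0 : 0 < d by rewrite /d; lra.
have b0 : 0 <= `|b| by [].
(* small enough for t * b <= d / 2 *)
pose t := d / (2 * (d + `|b|)).
have tE : t * (2 * (d + `|b|)) = d by rewrite /t mulfVK // gt_eqF //; lra.
have t0 : 0 < t by rewrite divr_gt0 //; lra.
have tb : t * b <= t * `|b| by rewrite ler_pM2l // ler_norm.
have td : 0 < t * d by rewrite mulr_gt0.
have t1 : t < 1 by rewrite ltr_pdivrMr; lra.
have := aux t (introT andP (conj t0 t1)).
have -> : gamma / 2 * (1 - t) * `|v - x| ^+ 2 = b - t * b by rewrite /b; ring.
by rewrite /d in tE td; lra.
Qed.

Lemma subdifferential_strongly_monotone x v g h :
  subdifferential G x g -> subdifferential G v h ->
  gamma * `|x - v| ^+ 2 <= hdot (g - h) (x - v).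
Proof.
move=> xg vh; have [r Gx] := subdifferential_fin xg.
have [s Gv] := subdifferential_fin vh.
have := strong_subgradient xg Gx Gv; have := strong_subgradient vh Gv Gx.
rewrite (distrC v x) !hdotE; lra.
Qed.

End StrongConvexity.

Section Growth.
Context {R : realType}.

(** With r the square root of phi n, the increment c must satisfy
    (r + c)^2 <= r^2 + s r; as r >= 1, it is enough that c (2 + c) <= s. *)
Lemma sqrt_growth (phi : nat -> R) (s : R) : 0 < s -> phi 0%N = 1 ->
  (forall i, phi i.+1 = phi i + s * Num.sqrt (phi i)) ->
  exists2 c : R, 0 < c & forall n, 1 + c * n%:R <= Num.sqrt (phi n).
Proof.
move=> s0 p0 pS; pose c := s / (2 + s).
have s2 : 0 < 2 + s by lra.
have c0 : 0 < c by rewrite divr_gt0.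
have cs : c * (2 + s) = s by rewrite /c mulfVK // gt_eqF.
have cs' : c <= s by rewrite ler_pdivrMr // ler_peMr; lra.
exists c => //; elim=> [|n IH]; first by rewrite p0 sqrtr1 mulr0 addr0.
have n0 : 0 <= c * n%:R by rewrite mulr_ge0 // ltW.
set r := Num.sqrt (phi n) in IH *.
have phn : phi n = r ^+ 2.
  rewrite sqr_sqrtr // leNgt; apply/negP => /ltW h.
  by move: IH; rewrite /r ler0_sqrtr //; lra.
have -> : 1 + c * n.+1%:R = (1 + c * n%:R) + c by rewrite -natr1; ring.
apply: le_trans (_ : r + c <= _); first by rewrite lerD2r.
rewrite -(@ger0_norm _ (r + c)); last by lra.
rewrite -sqrtr_sqr ler_sqrt pS -/r phn; nra.
Qed.

End Growth.

(** * Convergence of the method *)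

Section Iteration.
Context {R : realType} {X : hilbertType R} {J : euclideanJordanType R}.
Context {k : nat} (K : {linear X -> J}) (A : {linear J -> 'cV[R]_k}).

(** Strong monotonicity of the subdifferential at x1 and xhat leaves the coupling
    of y - yhat with K (x1 - xhat). Its part along K (x0 - xhat) is, by dual
    feasibility and A y = A yhat, the complementarity gap: the cross terms are
    nonnegative on the cone, and the central path equation bounds the rest by mu
    times the rank. The part along K (x1 - x0) is absorbed in the squared length
    of the step, at a cost quadratic in tau. *)
Lemma primal_dual_descent (G : X -> \bar R) gamma M Y tau mu
    (x0 x1 xhat : X) (y d yhat dhat : J) (z zhat : 'cV[R]_k) :
  eproper G -> strongly_convex G gamma ->
  (forall x, jnorm (K x) <= M * `|x|) -> 0 < tau ->
  jcone y -> jcone d -> jcone yhat -> jcone dhat ->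
  jnorm y <= Y -> jnorm yhat <= Y -> A y = A yhat ->
  subdifferential G xhat (- adjK K yhat) ->
  adjA A zhat - K xhat = dhat -> jmul yhat dhat = 0 ->
  adjA A z - K x0 = d -> jmul y d = mu *: junit ->
  resolvent tau (subdifferential G) (x0 - tau *: adjK K y) x1 ->
  (1 + 2 * gamma * tau) * `|x1 - xhat| ^+ 2
    <= `|x0 - xhat| ^+ 2 + 2 * tau * mu * jdot junit (junit : J)
       + tau ^+ 2 * (M ^+ 2 + 1) * (4 * Y ^+ 2).
Proof.
move=> pG cG KM tau0 cy cd cyh cdh yY yhY Ayy xhat_opt zhatE compl_hat zE compl.
move=> [g x1g step].
have hD := @jdot_aip R J.
have bK : bounded_operator K by exists M.
have mono := subdifferential_strongly_monotone pG cG x1g xhat_opt.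
have stepE : tau *: g = x0 - x1 - tau *: adjK K y.
  by rewrite addrAC step addrAC subrr add0r.
have pairing : jdot (K x0 - K xhat) (y - yhat) >= - (mu * jdot junit (junit : J)).
  have -> : K x0 - K xhat = (adjA A z - adjA A zhat) - (d - dhat).
    by rewrite -zE -zhatE; apply: jext => f; rewrite !scalE; ring.
  have Ay0 : A (y - yhat) = 0 by rewrite linearB Ayy subrr.
  have az := jdot_adjA_eq0 z Ay0; have azh := jdot_adjA_eq0 zhat Ay0.
  have y_d : jdot y d = mu * jdot junit (junit : J).
    rewrite /jdot compl jmul1; have := aipZ hD mu junit junit.
    by rewrite /jdot jmulZl jmul1.
  have yh_dh : jdot yhat dhat = 0.
    by have := aip0 hD junit; rewrite /jdot compl_hat jmul0l.
  have := jdot_cone_ge0 cy cdh; have := jdot_cone_ge0 cyh cd.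
  rewrite (aipC hD _ (y - yhat)) (aipDr hD (_ - _)) (aipNr hD).
  rewrite (aipDr hD (adjA A z)) (aipNr hD (adjA A zhat)) az azh.
  rewrite !(aipE hD) y_d yh_dh; lra.
(* this weight in Young's inequality makes the term in K (x1 - x0) at most the
   squared step length; the 1 avoids dividing by M *)
pose s := (tau * (M ^+ 2 + 1))^-1.
have M1 : 0 < M ^+ 2 + 1 by rewrite ltr_wpDl ?sqr_ge0.
have s0 : 0 < s by rewrite invr_gt0 mulr_gt0.
have tauM0 : 0 < tau * (M ^+ 2 + 1) by rewrite mulr_gt0.
have sE : tau * s * (M ^+ 2 + 1) = 1.
  by rewrite mulrAC /s mulfV // gt_eqF.
have young := jdot_weighted_young (- K (x1 - x0)) (y - yhat) s0.
have Kn : tau * s * jnorm (- K (x1 - x0)) ^+ 2 <= `|x1 - x0| ^+ 2.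
  rewrite -scaleN1r jnormZ normrN1 mul1r -[leRHS]mul1r -sE -[leRHS]mulrA ler_pM2l ?mulr_gt0 //.
  apply: le_trans (_ : (M * `|x1 - x0|) ^+ 2 <= _).
    by rewrite lerXn2r ?nnegrE ?jnorm_ge0 // (le_trans (jnorm_ge0 _) (KM _)).
  by rewrite exprMn ler_wpM2r ?sqr_ge0 // lerDl.
have yn : jnorm (y - yhat) ^+ 2 <= 4 * Y ^+ 2.
  have h1 : jnorm y ^+ 2 <= Y ^+ 2.
    by rewrite lerXn2r ?nnegrE ?jnorm_ge0 // (le_trans (jnorm_ge0 _) yY).
  have h2 : jnorm yhat ^+ 2 <= Y ^+ 2.
    by rewrite lerXn2r ?nnegrE ?jnorm_ge0 // (le_trans (jnorm_ge0 _) yhY).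
  have := jdot_ge0 (y + yhat); move: h1 h2.
  by rewrite !jnorm_sqr !(aipE hD); lra.
have sV : (2 * s)^-1 = tau * (M ^+ 2 + 1) / 2.
  by rewrite invfM /s invrK mulrC.
have young' : - (2 * tau * jdot (K (x1 - x0)) (y - yhat))
    <= `|x1 - x0| ^+ 2 + tau ^+ 2 * (M ^+ 2 + 1) * (4 * Y ^+ 2).
  have h : tau ^+ 2 * (M ^+ 2 + 1) * jnorm (y - yhat) ^+ 2
      <= tau ^+ 2 * (M ^+ 2 + 1) * (4 * Y ^+ 2).
    by rewrite ler_wpM2l // mulr_ge0 ?sqr_ge0 // ltW.
  move: young; rewrite sV (aipN hD) -(@ler_pM2l _ (2 * tau)) ?mulr_gt0 //.
  lra.
have pairing' : - (2 * tau * (mu * jdot junit (junit : J)))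
    <= 2 * tau * jdot (K x0 - K xhat) (y - yhat).
  by rewrite -mulrN ler_pM2l ?mulr_gt0.
have mono' : tau * (gamma * `|x1 - xhat| ^+ 2)
    <= hdot (x0 - x1 - tau *: adjK K y + tau *: adjK K yhat) (x1 - xhat).
  rewrite -stepE -scalerDr hdotZ ler_pM2l //.
  by move: mono; rewrite opprK.
move: mono' pairing' young' {young Kn yn pairing mono}.
rewrite -!hdot_norm !hdotE !(hdotC (adjK K _)) -!adjKP // !linearB !(aipE hD).
rewrite (hdotC x1 x0) (hdotC xhat x0) (hdotC xhat x1); lra.
Qed.

End Iteration.

Theorem mainTheorem1 (R : realType) (X : hilbertType R)
    (J : euclideanJordanType R) (k : nat)
    (K : {linear X -> J}) (A : {linear J -> 'cV[R]_k}) (b : 'cV[R]_k)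
    (G : X -> \bar R) (gamma : R) (a : J) (b0 : R)
    (xhat : X) (yhat dhat : J) (zhat : 'cV[R]_k)
    (theta zeta : R) (mu omega phi tau : nat -> R)
    (x : nat -> X) (y d : nat -> J) (z : nat -> 'cV[R]_k) :
  bounded_operator K ->
  (* the step lengths of the method divide by the norm of K *)
  (exists v, K v != 0) ->
  (exists2 y0, jinterior jcone y0 & A y0 = b) ->
  eproper G -> lower_semicontinuous G ->
  0 < gamma -> strongly_convex G gamma ->
  jinterior jcone a -> 0 < b0 -> (forall v, A v = b -> jdot a v = b0) ->
  jcone yhat -> jcone dhat ->
  subdifferential G xhat (- adjK K yhat) ->
  A yhat = b ->
  adjA A zhat - K xhat = dhat ->
  jmul yhat dhat = 0 ->
  strictly_complementary yhat dhat ->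
  dual_nondegenerate A dhat ->
  primal_nondegenerate A yhat ->
  0 < theta -> 0 < zeta < b0 ^- 2 ->
  (forall i, mu i.+1 = theta * phi i `^ (- (1 / 2))) ->
  (forall i, omega i.+1 = zeta * lambda_min a * mu i.+1) ->
  barrier_primal_dual G gamma K A b mu omega phi tau x y d z ->
  bounded_set (edom G) \/ bounded_fun x ->
  (fun N : nat => `|x N - xhat| ^+ 2 : R^o) =O_\oo
    (fun N : nat => N%:R^-1 : R^o).
Proof.
move=> bK Knz _ pG _ gamma0 cG aint b0_gt0 ab0 cyh cdh xhat_opt Ayh zhatE compl_hat.
move=> _ _ _ theta0 _ muE omegaE [mu0 omega0 phi0 tauE phiS yint dint Ay zE compl step] _.
have [M KM] := bK.
have [C C0 aC] := jnorm_le_interior aint.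
have Ybound v : jcone v -> A v = b -> jnorm v <= C * b0.
  by move=> cv Av; rewrite -(ab0 v Av); apply: aC.
have K0 := opnorm_gt0 bK Knz.
have [kappa kappa0 tau_mu] : exists2 kappa, 0 < kappa &
    forall i, tau i = kappa * mu i.+1.
  exists (2 * (zeta * lambda_min a) / opnorm K ^+ 2).
    rewrite divr_gt0 ?exprn_gt0 // mulr_gt0 //.
    by have := omega0 0%N; rewrite omegaE pmulr_lgt0.
  by move=> i; rewrite tauE omegaE; field; rewrite gt_eqF.
have tau0 i : 0 < tau i by rewrite tau_mu mulr_gt0.
have phi_gt0 i : 0 < phi i.
  elim: i => [|i IH]; first by rewrite phi0.
  by rewrite phiS mulr_gt0 // addr_gt0 // !mulr_gt0.
have muV i : mu i.+1 = theta / Num.sqrt (phi i).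
  by rewrite muE div1r powRN powR12_sqrt // ltW.
have sq0 i : 0 < Num.sqrt (phi i) by rewrite sqrtr_gt0.
have sqE i : phi i = Num.sqrt (phi i) ^+ 2 by rewrite sqr_sqrtr // ltW.
have [|||c c0 growth] := @sqrt_growth _ phi (2 * gamma * kappa * theta).
- by rewrite !mulr_gt0.
- exact: phi0.
- move=> i; rewrite phiS tau_mu muV.
  move: (Num.sqrt (phi i)) (sqE i) (sq0 i) => r -> r0; field.
  by rewrite gt_eqF.
pose n i : R := `|x i - xhat| ^+ 2.
(* phi i * mu i.+1 ^+ 2 = theta ^+ 2, so the error of a step is constant after
   multiplication by phi i *)
pose E : R := theta ^+ 2 * (2 * kappa * jdot junit (junit : J)
  + kappa ^+ 2 * (M ^+ 2 + 1) * (4 * (C * b0) ^+ 2)).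
have descent i : phi i.+1 * n i.+1 <= phi i * n i + E.
  have cy := jinterior_sub (yint i); have cd := jinterior_sub (dint i).
  have := primal_dual_descent pG cG KM (tau0 i) cy cd cyh cdh
    (Ybound _ cy (Ay i)) (Ybound _ cyh Ayh) _ xhat_opt zhatE compl_hat (zE i)
    (compl i) (step i).
  rewrite Ay Ayh => /(_ erefl); rewrite -/(n i) -/(n i.+1) => h.
  rewrite phiS -mulrA; apply: le_trans (ler_wpM2l (ltW (phi_gt0 i)) h) _.
  rewrite !mulrDr -addrA lerD2l le_eqVlt; apply/orP; left; apply/eqP.
  rewrite tau_mu muV /E.
  move: (Num.sqrt (phi i)) (sqE i) (sq0 i) => r -> r0; field.
  by rewrite gt_eqF.
have total N : phi N * n N <= n 0%N + E * N%:R.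
  elim: N => [|N IH]; first by rewrite phi0 mul1r mulr0 addr0.
  apply: le_trans (descent N) _; rewrite -natr1 mulrDr mulr1 addrA.
  by rewrite lerD2r.
have E0 : 0 <= E.
  rewrite /E mulr_ge0 ?sqr_ge0 // addr_ge0 // !mulr_ge0 ?sqr_ge0 ?jdot_ge0 ?(ltW kappa0) ?(ltW C0) ?(ltW b0_gt0) //.
  by rewrite addr_ge0 ?sqr_ge0.
have n0 i : 0 <= n i by rewrite sqr_ge0.
apply/eqO_exP; exists ((n 0%N + E) / c ^+ 2 + 1).
  by rewrite ltr_wpDl // divr_ge0 ?sqr_ge0 // addr_ge0.
near=> N.
have N0 : (0 < N)%N by near: N; exists 1%N.
have NR : 1 <= N%:R :> R by rewrite ler1n.
rewrite -/(n N) ger0_norm // ger0_norm ?invr_ge0 ?ler0n //.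
rewrite ler_pdivlMr ?(lt_le_trans ltr01 NR) //.
have cN : (c * N%:R) ^+ 2 <= phi N.
  rewrite [phi N]sqE lerXn2r ?nnegrE ?(ltW (sq0 _)) //.
    by rewrite mulr_ge0 ?ltW // (lt_le_trans ltr01 NR).
  by apply: le_trans (growth N); rewrite lerDr.
apply: le_trans (_ : (n 0%N + E) / c ^+ 2 <= _); last by rewrite lerDl.
rewrite ler_pdivlMr ?exprn_gt0 //.
have NR0 : 0 < N%:R :> R by apply: lt_le_trans NR.
rewrite -(ler_pM2r NR0).
have h1 : (c * N%:R) ^+ 2 * n N <= n 0%N + E * N%:R.
  by apply: le_trans (total N); rewrite ler_wpM2r.
have h2 : n 0%N <= n 0%N * N%:R by rewrite ler_peMr.
move: h1 h2; rewrite exprMn; lra.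
Unshelve. all: by end_near. Qed.
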